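(* Let $\{g_t,\ t\in(-\epsilon,\epsilon)\}\subset\mathrm{Riem}(M,\mathcal V,g_0)$ be a variation such that $\pi:(M,g_t)\to(N,g_N)$ is a Riemannian submersion for all $t\in(-\epsilon,\epsilon)$ and, for every vertical $X$, $$B_t^\sharp X=\sum_{i=n+1}^{n+p}g_0(V_i,X)\,P^t_{\mathcal H}\pi^*W_i,$$ where $\{W_{n+1},\dots,W_{n+p}\}$ are $g_N$-orthonormal vector fields on $N$ and $V_i$ are vertical vector fields (possibly depending on $t$). Write $W_i^t=P^t_{\mathcal H}\pi^*W_i$. Then for all $i\neq j$ $$\partial_t\sec_{(M,g_t)}(W_i^t,W_j^t)=-\tfrac32\sum_{k=n+1}^{n+p}g_N([W_i,W_j],W_k)\,g_t(V_k,P^t_{\mathcal V}[W_i^t,W_j^t])+\tfrac32g_t\big([V_i,W_j^t]+[W_i^t,V_j],P^t_{\mathcal V}[W_i^t,W_j^t]\big)$$ and $$\partial^2_{t}\sec_{(M,g_t)}(W_i^t,W_j^t)=-\tfrac32\sum_{k}g_N([W_i,W_j],W_k)\,g_t(\partial_tV_k,P^t_{\mathcal V}[W_i^t,W_j^t])$$ $$-\tfrac32\sum_{k,l}g_N([W_i,W_j],W_k)\,g_N([W_i,W_j],W_l)\,g_t(V_k,V_l)+3\sum_kg_N([W_i,W_j],W_k)\,g_t\big(V_k,[V_i,W_j^t]+[W_i^t,V_j]\big)$$ $$+\tfrac32g_t\big([\partial_tV_i,W_j^t]+[W_i^t,\partial_tV_j],P^t_{\mathcal V}[W_i^t,W_j^t]\big)-3g_t\big([V_i,V_j],P^t_{\mathcal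 V}[W_i^t,W_j^t]\big)$$ $$-\tfrac32g_t\big([V_i,W_j^t]+[W_i^t,V_j],[V_i,W_j^t]+[W_i^t,V_j]\big),$$ where all sums run over $n+1,\dots,n+p$ and functions on $N$ are pulled back to $M$.
   Context: $M$, $N$ are smooth, connected, oriented manifolds, $\dim M=n+p$, $\dim N=p$; all functions and tensor fields are smooth. $\pi:(M,g_0)\to(N,g_N)$ is a Riemannian submersion; $\mathcal V$ is the vertical distribution. $\mathrm{Riem}(M,\mathcal V,g_0)$ is the set of metrics $g$ on $M$ with $g(X,Y)=g_0(X,Y)$ for all vertical $X,Y$. A variation of $g_0$ is a one-parameter family $g_t$ in this set (equal to $g_0$ at $t=0$), smooth in $t$. $\mathcal H(t)$ is the $g_t$-orthogonal complement of $\mathcal V$; $P^t_{\mathcal V},P^t_{\mathcal H}$ are the $g_t$-orthogonal projections onto $\mathcal V$, $\mathcal H(t)$. $\pi:(M,g_t)\to(N,g_N)$ is a Riemannian submersion if $g_t(X,Y)=g_N(\pi_*X,\pi_*Y)$ for $X,Y$ in $\mathcal H(t)$. $B_t=\partial_tg_t$ and $g_t(B_t^\sharp X,Y)=B_t(X,Y)$. For a vector field $W$ on $N$, $\pi^*W$ is its $g_0$-horizontal lift. $\sec_{(M,g_t)}(X,Y)$ is the sectional curvature of the plane spanned by linearly independent $X,Y$. *)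

(* Defs.v *)
From HB Require Import structures.
From mathcomp Require Import all_boot all_order all_algebra.
From mathcomp Require Import all_classical all_reals all_analysis.

Set Implicit Arguments.
Unset Strict Implicit.
Unset Printing Implicit Defensive.

Import Order.TTheory GRing.Theory Num.Theory.
Import numFieldNormedType.Exports.

Local Open Scope classical_set_scope.
Local Open Scope ring_scope.

(** * Smooth maps on open subsets of finite-dimensional normed spaces *)

(* Iterated directional derivatives, the head of [vs] being applied last. *)
Fixpoint iter_deriv {R : realType} {V W : normedModType R} (f : V -> W)
    (vs : seq V) : V -> W :=
  if vs is v :: vs' then fun x => 'D_v (iter_deriv f vs') x else f.

(* For U open and V finite-dimensional this is C^oo on U: all the iterated
   directional derivatives exist and are (Frechet) differentiable, hence
   continuous, on U.  The values of f outside U are irrelevant. *)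
Definition smooth_on {R : realType} {V W : normedModType R} (U : set V)
    (f : V -> W) : Prop :=
  forall vs x, U x -> differentiable (iter_deriv f vs) x.

(** * Smooth manifolds *)

(* [bwd] is only meaningful on the open set [chart_image], and [fwd] on [chart_dom]. *)
Record chart (R : realType) (m : nat) (M : topologicalType) := Chart {
  chart_dom : set M;
  fwd : M -> 'rV[R]_m;
  bwd : 'rV[R]_m -> M;
  chart_dom_open : open chart_dom;
  chart_image_open : open (fwd @` chart_dom);
  fwdK : forall x, chart_dom x -> bwd (fwd x) = x;
  fwd_cts : forall x, chart_dom x -> {for x, continuous fwd};
  bwd_cts : forall u, (fwd @` chart_dom) u -> {for u, continuous bwd} }.

Definition chart_image {R : realType} {m : nat} {M : topologicalType}
    (c : chart R m M) : set 'rV[R]_m := fwd c @` chart_dom c.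

(* [chart_at x] is a distinguished chart around x; its only role is to identify
   the tangent space at x with 'rV[R]_m (see [tangent]). *)
Record manifold (R : realType) (m : nat) := Manifold {
  carrier :> topologicalType;
  manifold_hausdorff : hausdorff_space carrier;
  manifold_second_countable : @second_countable carrier;
  atlas : set (chart R m carrier);
  chart_at : carrier -> chart R m carrier;
  atlas_smooth : forall c c', atlas c -> atlas c' ->
    smooth_on (fwd c @` (chart_dom c `&` chart_dom c')) (fwd c' \o bwd c);
  chart_at_atlas : forall x, atlas (chart_at x);
  chart_at_in : forall x, chart_dom (chart_at x) x }.

(* T_x M: a tangent vector at x is given by its components in [chart_at x]. *)
Definition tangent {R : realType} {m : nat} {M : manifold R m} (x : M) : Type :=
  'rV[R]_m.

(* If v is the vector of components in the chart c of a tangent vector at x,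
   [chart_change c c' x v] is the vector of its components in the chart c'. *)
Definition chart_change {R : realType} {m : nat} {M : manifold R m}
    (c c' : chart R m M) (x : M) (v : 'rV[R]_m) : 'rV[R]_m :=
  'd (fwd c' \o bwd c) (fwd c x) v.

(* An orientation chooses one of the two classes of frames in each T_x M: the
   coordinate frame of [chart_at x] is positive iff [o x].  The condition says
   that the coordinate frame of any chart c of the atlas is, locally,
   everywhere positive or everywhere negative. *)
Definition orientation {R : realType} {m : nat} (M : manifold R m)
    (o : M -> bool) : Prop :=
  let positive c x := (0 < \det (lin1_mx (chart_change c (chart_at x) x))) == o x in
  forall c x, atlas c -> chart_dom c x ->
    \forall y \near x, positive c y = positive c x.

Section SmoothMaps.
Context {R : realType} {m k : nat} {M : manifold R m} {N : manifold R k}.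

Definition smooth_map (f : M -> N) : Prop :=
  continuous f /\
  forall c d, atlas c -> atlas d ->
    smooth_on (fwd c @` (chart_dom c `&` f @^-1` chart_dom d)) (fwd d \o f \o bwd c).

Definition dmap (f : M -> N) (x : M) (v : tangent x) : tangent (f x) :=
  'd (fwd (chart_at (f x)) \o f \o bwd (chart_at x)) (fwd (chart_at x) x) v.

End SmoothMaps.

Arguments dmap {R m k M N} f x v.

(** * Vector fields and metrics *)

Section Tensors.
Context {R : realType} {m : nat} {M : manifold R m}.

Definition vfield := forall x : M, tangent x.

(* The components of X in the chart c, as a function on [chart_image c]. *)
Definition local_field (c : chart R m M) (X : vfield) (u : 'rV[R]_m) :
    'rV[R]_m :=
  let x := bwd c u in chart_change (chart_at x) c x (X x).

Definition smooth_field (X : vfield) : Prop :=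
  forall c, atlas c -> smooth_on (chart_image c) (local_field c X).

Definition smooth_field_family (e : R) (X : R -> vfield) : Prop :=
  forall c, atlas c ->
    smooth_on (`]- e, e[%classic `*` chart_image c)
      (fun z : R^o * 'rV[R]_m => local_field c (X z.1) z.2).

Definition lie_bracket (X Y : vfield) : vfield := fun x =>
  let c := chart_at x in
  let Xc := local_field c X in let Yc := local_field c Y in
  let u := fwd c x in 'D_(Xc u) Yc u - 'D_(Yc u) Xc u.

(* The bilinear form with Gram matrix G. *)
Definition inner (G : 'M[R]_m) (v w : 'rV[R]_m) : R := (v *m G *m w^T) 0 0.

(* [g x] is the Gram matrix at x in the coordinates of [chart_at x]. *)
Definition tensor2 := M -> 'M[R]_m.

(* The Gram matrix of g in the coordinates of the chart c. *)
Definition local_gram (c : chart R m M) (g : tensor2) (u : 'rV[R]_m) :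
    'M[R]_m :=
  let x := bwd c u in
  let J := lin1_mx (chart_change c (chart_at x) x) in J *m g x *m J^T.

Definition riemannian_metric (g : tensor2) : Prop :=
  [/\ forall x, (g x)^T = g x,
      forall x (v : tangent x), v != 0 -> 0 < inner (g x) v v
    & forall c, atlas c -> smooth_on (chart_image c) (local_gram c g)].

Definition smooth_tensor2_family (e : R) (g : R -> tensor2) : Prop :=
  forall c, atlas c ->
    smooth_on (`]- e, e[%classic `*` chart_image c)
      (fun z : R^o * 'rV[R]_m => local_gram c (g z.1) z.2).

(* The vector w with g(w, v) = b v for all v. *)
Definition sharp (g : tensor2) (x : M) (b : tangent x -> R) : tangent x :=
  xget (0 : 'rV[R]_m)
    [set w : 'rV[R]_m | forall v : tangent x, inner (g x) w v = b v].

End Tensors.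

Arguments vfield {R m} M.
Arguments tensor2 {R m} M.
Arguments sharp {R m M} g x b.

(** * Levi-Civita connection and sectional curvature, in coordinates *)

Section Curvature.
Context {R : realType} {m : nat}.
Implicit Types (G : 'rV[R]_m -> 'M[R]_m) (X Y Z : 'rV[R]_m -> 'rV[R]_m).

Definition partial (i : 'I_m) (f : 'rV[R]_m -> R^o) (u : 'rV[R]_m) : R :=
  'D_(delta_mx 0 i) f u.

(* The Christoffel symbol \Gamma^k_{ij}. *)
Definition christoffel G (i j k : 'I_m) (u : 'rV[R]_m) : R :=
  2^-1 * \sum_l invmx (G u) k l *
    (partial i (fun w => G w j l) u + partial j (fun w => G w i l) u
     - partial l (fun w => G w i j) u).

(* \nabla_X Y *)
Definition covD G X Y (u : 'rV[R]_m) : 'rV[R]_m :=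
  'D_(X u) Y u +
  \row_k \sum_i \sum_j X u 0 i * Y u 0 j * christoffel G i j k u.

(* R(X, Y) Z *)
Definition curv G X Y Z (u : 'rV[R]_m) : 'rV[R]_m :=
  covD G X (covD G Y Z) u - covD G Y (covD G X Z) u
  - covD G (fun w => 'D_(X w) Y w - 'D_(Y w) X w) Z u.

(* The curvature being tensorial, v and w are extended by constant fields. *)
Definition sec {M : manifold R m} (g : tensor2 M) (x : M) (v w : tangent x) :
    R :=
  let G := local_gram (chart_at x) g in
  let cst_field (a : 'rV[R]_m) := fun _ : 'rV[R]_m => a in
  let gx := inner (g x) in
  gx (curv G (cst_field v) (cst_field w) (cst_field w) (fwd (chart_at x) x)) v
  / (gx v v * gx w w - gx v w ^+ 2).

End Curvature.

Arguments sec {R m M} g x v w.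

(** * Riemannian submersions *)

Section Submersion.
Context {R : realType} {m k : nat} {M : manifold R m} {N : manifold R k}.
Variable pi : M -> N.

Definition submersion : Prop :=
  smooth_map pi /\
  forall (x : M) (w : tangent (pi x)), exists v : tangent x, dmap pi x v = w.

Definition vertical (x : M) (v : tangent x) : Prop :=
  dmap pi x v = (0 : 'rV[R]_k).

Definition horizontal (g : tensor2 M) (x : M) (v : tangent x) : Prop :=
  forall u : tangent x, vertical u -> inner (g x) v u = 0.

Definition riemannian_submersion (g : tensor2 M) (gN : tensor2 N) : Prop :=
  submersion /\
  forall (x : M) (v w : tangent x), horizontal g v -> horizontal g w ->
    inner (g x) v w = inner (gN (pi x)) (dmap pi x v) (dmap pi x w).

(* The g-orthogonal projections on the vertical and horizontal spaces. *)
Definition projV (g : tensor2 M) (x : M) (v : tangent x) : tangent x :=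
  xget (0 : 'rV[R]_m) [set w : 'rV[R]_m |
    vertical (x := x) w /\ horizontal g (x := x) ((v : 'rV[R]_m) - w)].

Definition projH (g : tensor2 M) (x : M) (v : tangent x) : tangent x :=
  xget (0 : 'rV[R]_m) [set w : 'rV[R]_m |
    horizontal g (x := x) w /\ vertical (x := x) ((v : 'rV[R]_m) - w)].

Definition hlift (g : tensor2 M) (W : vfield N) : vfield M := fun x =>
  xget (0 : 'rV[R]_m) [set v : 'rV[R]_m |
    horizontal g (x := x) v /\ dmap pi x v = W (pi x)].

Definition vertical_field (X : vfield M) : Prop := forall x, vertical (X x).

(* Riem(M, V, g0) *)
Definition Riem (g0 g : tensor2 M) : Prop :=
  riemannian_metric g /\
  forall (x : M) (v w : tangent x), vertical v -> vertical w ->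
    inner (g x) v w = inner (g0 x) v w.

(* A smooth curve in Riem(M, V, g0), defined for - e < t < e, with value g0 at
   t = 0; the values of g at the other times are irrelevant. *)
Definition metric_variation (e : R) (g0 : tensor2 M) (g : R -> tensor2 M) : Prop :=
  [/\ forall t, - e < t < e -> Riem g0 (g t),
      g 0 = g0
    & smooth_tensor2_family e g].

End Submersion.

Arguments vertical {R m k M N} pi x v.
Arguments horizontal {R m k M N} pi g x v.
Arguments projV {R m k M N} pi g x v.
Arguments projH {R m k M N} pi g x v.

(** * Time derivatives *)

Section TimeDerivatives.
Context {R : realType} {m : nat} {M : manifold R m}.

(* (\partial_t g_t)(v, w) *)
Definition dt_tensor2 (g : R -> tensor2 M) (t : R) (x : M)
    (v w : tangent x) : R :=
  derive1 (fun s : R => inner (g s x) v w : R^o) t.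

Definition dt_field (X : R -> vfield M) (t : R) : vfield M := fun x =>
  derive1 (fun s : R => (X s x : 'rV[R]_m)) t.

Definition field_add (X Y : vfield M) : vfield M := fun x =>
  (X x : 'rV[R]_m) + Y x.

End TimeDerivatives.

(* Main.v *)
Require Import Defs.
From mathcomp Require Import all_boot all_order all_algebra.
From mathcomp Require Import all_classical all_reals all_analysis.
From mathcomp Require Import ring lra.
Import Order.TTheory GRing.Theory Num.Theory.
Import numFieldNormedType.Exports.
Local Open Scope classical_set_scope.
Local Open Scope ring_scope.

Set Implicit Arguments.
Unset Strict Implicit.
Unset Printing Implicit Defensive.

(* For vertical X, the hypothesis on B_t says B_t(X, W_k^t) = g_t(V_k, X), and
   differentiating g_t(W_k^t, X) = 0 turns it into d/dt W_k^t = - V_k.  Hence the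
   vertical part A of [W_i^t, W_j^t], whose horizontal part is
   sum_k g_N([W_i, W_j], W_k) W_k^t, satisfies
     d/dt A = sum_k g_N([W_i, W_j], W_k) V_k - ([V_i, W_j^t] + [W_i^t, V_j]).
   By O'Neill's formula sec(W_i^t, W_j^t) = K - 3/4 |A|^2 with K independent of t,
   and |A|^2 is computed in a metric on the vertical space that does not depend
   on t, so that both derivatives follow from the product rule.

   O'Neill's formula is proved upstairs, without the curvature of N: by Koszul's
   formula nabla_{W_a} W_b = sum_k gamma_ab^k W_k + (vertical part of [W_a, W_b]) / 2,
   where gamma is made of the structure functions of the frame W of N, and
   derivatives of functions lifted from N along W_a do not depend on the metric. *)

(** * Smooth maps *)

(** The lifts, projections and sharps of the statement are picked pointwise by [xget], so their
    properties follow only once a solution is shown to exist, and their smoothness in space and time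
    does not come for free. A vector both vertical and horizontal has norm zero; this uniqueness
    identifies the lifted frame with an explicit matrix expression in the metric and the
    differential of [pi], smooth on the product of the time interval and a chart overlap. On that
    product Schwarz's theorem lets the time derivative pass through spatial brackets. For every t
    the frame W_k^t is g_t-orthonormal and related to W_k, so the coefficients of the horizontal
    part of [W_i^t, W_j^t] are lifted from N and frozen in time. [sec] extends vectors by constant
    fields while O'Neill's formula concerns the frame fields; tensoriality of the curvature bridges
    the two. With D = dA/dt, the derivatives of sec are -3/2 g(D, A) and -3/2 (g(dD/dt, A) + g(D,
    D)). Both summands of [V_i, W_j^t] + [W_i^t, V_j] contribute -[V_i, V_j] to its time derivative,
    so dD/dt contains 2 [V_i, V_j], whence the coefficient -3. *)

Section Differentiable.
Context {R : realType} {V : normedModType R}.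

(** The differential is chosen among the continuous linear maps that satisfy an expansion at [x], so
    one candidate suffices; the remainder is moved from 0 to [x] by a translation. *)
Lemma differentiable_linear_approx (W : normedModType R) (f : V -> W)
    (df : {linear V -> W}) x :
  continuous df -> f \o shift x = cst (f x) + df +o_ 0 id -> differentiable f x.
Proof.
move=> dfc dxf; apply/diffP => /=.
apply: (@getPex _ (fun (df : {linear V -> W}) => continuous df /\
  forall y, f y = f (lim (nbhs x)) + df (y - lim (nbhs x))
                  +o_(y \near x) (y - lim (nbhs x)))).
exists df; split=> //; apply: eqaddoEx => z; rewrite lim_id //.
have dxf' h : f (h + x) = f x + df h +o_(h \near 0) h.
  by have := congr1 (fun g : V -> W => g h) dxf.
rewrite -[in LHS](subrK x z) dxf'; congr (_ + _).
rewrite -(comp_centerK x id) -[X in the_littleo _ _ _ X](comp_centerK x).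
by rewrite -[_ (z - x)]/((_ \o (center x)) z) -littleo_center0.
Qed.

(** The perturbation [g - f] vanishes near [x], so it has differential 0 there. *)
Lemma near_eq_differentiable (W : normedModType R) (f g : V -> W) x :
  {near x, f =1 g} -> differentiable f x -> differentiable g x.
Proof.
move=> fg df; rewrite (_ : g = f + (g - f)); last first.
  by apply/funext => y; rewrite !fctE subrKC.
apply: differentiableD => //.
apply: (@differentiable_linear_approx _ _ (\0 : {linear V -> W})).
  exact: cst_continuous.
have gf0 : (g - f) \o shift x =o_ 0 id.
  apply/eqoP => _/posnumP[eps]; near=> y => /=.
  rewrite !fctE (_ : g _ = f (y + x)) ?subrr ?normr0 ?mulr_ge0//.
  apply/esym; near: y; have := fg; rewrite (near_shift 0 x (fun y => f y = g y)) /=.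
  by apply: filterS => z; rewrite subr0.
apply/eqaddoE; rewrite [LHS]gf0 funeqE => y /=.
by rewrite !fctE -(nbhs_singleton fg) subrr !add0r.
Unshelve. all: by end_near. Qed.

End Differentiable.

Section Smooth.
Context {R : realType}.
Implicit Types V W : normedModType R.

(* n + 1 times differentiable; see [smooth_onP] for the link with [smooth_on]. *)
Fixpoint Cn {V W} n (U : set V) (f : V -> W) : Prop :=
  (forall x, U x -> differentiable f x) /\
  (if n is n'.+1 then forall v, Cn n' U ('D_v f) else True).

Lemma Cn_diff {V W} n (U : set V) (f : V -> W) x : Cn n U f -> U x -> differentiable f x.
Proof. by case: n => [|n] [+ _]; apply. Qed.

Lemma Cn_derive {V W} n (U : set V) (f : V -> W) v : Cn n.+1 U f -> Cn n U ('D_v f).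
Proof. by move=> [_]; exact. Qed.

Lemma Cn_pred {V W} n (U : set V) (f : V -> W) : Cn n.+1 U f -> Cn n U f.
Proof.
elim: n f => [|n IH] f [df Df]; first by split.
by split=> // v; apply: IH; exact: Df.
Qed.

(** [iter_deriv] applies the head of its list last whereas [Cn] starts from a first derivative; the
    two recursions meet by peeling off the last entry of the list. *)
Lemma smooth_onP {V W} (U : set V) (f : V -> W) :
  smooth_on U f <-> forall n, Cn n U f.
Proof.
split=> [sf n|Cf vs].
  elim: n f sf => [|n IH] f sf; first by split=> //; exact: (sf [::]).
  split=> [|v]; first exact: (sf [::]).
  apply: IH => vs x Ux; have := sf (rcons vs v) x Ux.
  suff -> : iter_deriv f (rcons vs v) = iter_deriv ('D_v f) vs by [].
  by elim: vs => //= w vs ->.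
elim/last_ind: vs f Cf => [|vs v IH] f Cf x Ux; first exact: (Cn_diff (Cf 0%N) Ux).
rewrite (_ : iter_deriv f (rcons vs v) = iter_deriv ('D_v f) vs).
  by apply: IH => // n; exact: Cn_derive (Cf n.+1).
by elim: vs {IH} => //= w vs ->.
Qed.

Lemma near_open_eq {V W} (U : set V) (f g : V -> W) x :
  open U -> {in U, f =1 g} -> U x -> {near x, f =1 g}.
Proof.
move=> oU fg Ux; apply: filterS (open_nbhs_nbhs (conj oU Ux)) => y Uy.
by apply: fg; rewrite inE.
Qed.

Lemma derive_eq_on {V W} (U : set V) (f g : V -> W) x v :
  open U -> {in U, f =1 g} -> U x -> 'D_v f x = 'D_v g x.
Proof. by move=> oU fg Ux; apply: near_eq_derive; exact: near_open_eq Ux. Qed.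

Lemma Cn_eq {V W} n (U : set V) (f g : V -> W) :
  open U -> {in U, f =1 g} -> Cn n U f -> Cn n U g.
Proof.
move=> oU; elim: n f g => [|n IH] f g fg [df Df]; (split; first by move=> x Ux;
    exact: near_eq_differentiable (near_open_eq oU fg Ux) (df x Ux)) => //.
- move=> v; apply: IH (Df v) => x; rewrite inE => Ux.
  exact: derive_eq_on fg Ux.
Qed.

Lemma Cn_sub {V W} n (U U' : set V) (f : V -> W) :
  U `<=` U' -> Cn n U' f -> Cn n U f.
Proof.
move=> UU'; elim: n f => [|n IH] f [df Df]; (split; first by move=> x /UU'; exact: df) => //.
by move=> v; exact: IH (Df v).
Qed.

Lemma Cn_cst {V W} n (U : set V) (w : W) : Cn n U (fun _ : V => w).
Proof.
elim: n w => [|n IH] w; split=> //; move=> v.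
rewrite (_ : 'D_v _ = fun=> 0) //; apply/funext => x.
by have := derive_cst w x v.
Qed.

Lemma Cn_comp_linear {V W W'} n (U : set V) (f : V -> W) (L : {linear W -> W'}) :
  open U -> continuous L -> Cn n U f -> Cn n U (L \o f).
Proof.
move=> oU cL; elim: n f => [|n IH] f [df Df].
  split=> // x Ux; apply: differentiable_comp (df x Ux) _.
  exact: linear_differentiable.
split=> [x Ux|v].
  by apply: differentiable_comp (df x Ux) _; exact: linear_differentiable.
apply: Cn_eq (IH _ (Df v)) => // x; rewrite inE => Ux /=.
have dLf := differentiable_comp (df x Ux) (linear_differentiable (f x) cL).
rewrite [RHS]deriveE// deriveE; last exact: df.
by rewrite (diff_comp (df x Ux) (linear_differentiable (f x) cL)) /= diff_lin.
Qed.

Lemma CnD {V W} n (U : set V) (f g : V -> W) :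
  open U -> Cn n U f -> Cn n U g -> Cn n U (fun x => f x + g x).
Proof.
move=> oU; elim: n f g => [|n IH] f g [df Df] [dg Dg].
  by split=> // x Ux; apply: differentiableD; auto.
split=> [x Ux|v]; first by apply: differentiableD; auto.
apply: Cn_eq (IH _ _ (Df v) (Dg v)) => // x; rewrite inE => Ux.
by rewrite -deriveD//; apply: diff_derivable; auto.
Qed.

Lemma Cn_sum {V W} n (U : set V) (I : Type) (r : seq I) (P : pred I) (f : I -> V -> W) :
  open U -> (forall i, P i -> Cn n U (f i)) -> Cn n U (fun x => \sum_(i <- r | P i) f i x).
Proof.
move=> oU Cf; elim: r => [|i r IH].
  apply: Cn_eq (Cn_cst n U (0 : W)) => // x _ /=.
  by rewrite big_nil.
case Pi : (P i); last first.
  by apply: Cn_eq IH => // x _; rewrite big_cons Pi.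
apply: Cn_eq (CnD oU (Cf i Pi) IH) => // x _ /=.
by rewrite big_cons Pi.
Qed.

Lemma CnM {V} n (U : set V) (f g : V -> R^o) :
  open U -> Cn n U f -> Cn n U g -> Cn n U (fun x => f x * g x : R^o).
Proof.
move=> oU; elim: n f g => [|n IH] f g Cf Cg.
  by split=> // x Ux; apply: differentiableM; [exact: (Cn_diff Cf)|exact: (Cn_diff Cg)].
split=> [x Ux|v].
  by apply: differentiableM; [exact: (Cn_diff Cf)|exact: (Cn_diff Cg)].
have C1 := IH _ _ (Cn_pred Cf) (Cn_derive v Cg).
have C2 := IH _ _ (Cn_pred Cg) (Cn_derive v Cf).
apply: Cn_eq (CnD oU C1 C2) => // x; rewrite inE => Ux.
rewrite -[LHS]deriveM//; apply: diff_derivable; [exact: (Cn_diff Cf)|exact: (Cn_diff Cg)].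
Qed.

Lemma CnV {V} n (U : set V) (f : V -> R^o) :
  open U -> (forall x, U x -> f x != 0) -> Cn n U f -> Cn n U (fun x => (f x)^-1 : R^o).
Proof.
move=> oU f0; elim: n f f0 => [|n IH] f f0 Cf.
  by split=> // x Ux; apply: differentiableV; [exact: (Cn_diff Cf)|exact: f0].
split=> [x Ux|v].
  by apply: differentiableV; [exact: (Cn_diff Cf)|exact: f0].
have C1 := IH _ f0 (Cn_pred Cf).
(* The derivative -f^-2 D_v f is written as a product of factors f^-1, to which the induction
   hypothesis applies. *)
have C2 := CnM oU (Cn_cst n U (-1 : R^o)) (CnM oU C1 (CnM oU C1 (Cn_derive v Cf))).
apply: Cn_eq C2 => // x; rewrite inE => Ux.
have /= := @deriveV _ _ f x v (f0 x Ux) (diff_derivable (Cn_diff Cf Ux)).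
move=> H; rewrite [RHS]H.
rewrite /GRing.scale /= expr2 invfM; ring.
Qed.

Lemma Cn_prod {V} n (U : set V) (I : Type) (r : seq I) (P : pred I) (f : I -> V -> R^o) :
  open U -> (forall i, P i -> Cn n U (f i)) ->
  Cn n U (fun x => \prod_(i <- r | P i) f i x : R^o).
Proof.
move=> oU Cf; elim: r => [|i r IH].
  apply: Cn_eq (Cn_cst n U (1 : R^o)) => // x _ /=.
  by rewrite big_nil.
case Pi : (P i); last first.
  by apply: Cn_eq IH => // x _; rewrite big_cons Pi.
apply: Cn_eq (CnM oU (Cf i Pi) IH) => // x _ /=.
by rewrite big_cons Pi.
Qed.

End Smooth.

(** * Smoothness of matrix-valued functions and of compositions *)

Section SmoothMatrix.
Context {R : realType}.
Implicit Types V W : normedModType R.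

Lemma differentiable_entry {V} a b (f : V -> 'M[R]_(a, b)) i j x :
  differentiable f x -> differentiable (fun y => f y i j : R^o) x.
Proof. by move=> df; exact: differentiable_comp df (differentiable_coord _ _ _). Qed.

Lemma differentiable_mx {V} a b (f : V -> 'M[R]_(a, b)) x :
  (forall i j, differentiable (fun y => f y i j : R^o) x) -> differentiable f x.
Proof.
move=> df.
rewrite (_ : f = \sum_(i < a) \sum_(j < b) fun y => f y i j *: delta_mx i j).
  apply: differentiable_sum => i; apply: differentiable_sum => j.
  exact: differentiableZl (df i j).
apply/funext => y; rewrite fct_sumE [LHS]matrix_sum_delta.
by apply: eq_bigr => i _; rewrite fct_sumE.
Qed.

Lemma derive_entry {V} a b (f : V -> 'M[R]_(a, b)) i j x v :
  differentiable f x -> 'D_v (fun y => f y i j : R^o) x = 'D_v f x i j.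
Proof. by move=> df; rewrite derive_mx ?mxE//; exact: diff_derivable. Qed.

Lemma Cn_mx {V} n (U : set V) a b (f : V -> 'M[R]_(a, b)) : open U ->
  (forall i j, Cn n U (fun y => f y i j : R^o)) <-> Cn n U f.
Proof.
move=> oU; elim: n f => [|n IH] f.
  split=> [Cf|Cf i j]; split=> // x Ux.
    by apply: differentiable_mx => i j; exact: Cn_diff (Cf i j) Ux.
  by apply: differentiable_entry; exact: Cn_diff Cf Ux.
split=> [Cf|Cf i j].
  have df x : U x -> differentiable f x.
    by move=> Ux; apply: differentiable_mx => i j; exact: Cn_diff (Cf i j) Ux.
  split=> // v; apply/IH => i j.
  apply: Cn_eq (Cn_derive v (Cf i j)) => // x; rewrite inE => Ux.
  by rewrite derive_entry//; exact: df.
split=> [x Ux|v]; first by apply: differentiable_entry; exact: Cn_diff Cf Ux.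
have /IH/(_ i j) := Cn_derive v Cf.
apply: Cn_eq => // x; rewrite inE => Ux.
by rewrite derive_entry//; exact: Cn_diff Cf Ux.
Qed.

Lemma Cn_mulmx {V} n (U : set V) a b c (f : V -> 'M[R]_(a, b)) (g : V -> 'M[R]_(b, c)) :
  open U -> Cn n U f -> Cn n U g -> Cn n U (fun x => f x *m g x).
Proof.
move=> oU /(Cn_mx _ _ oU) Cf /(Cn_mx _ _ oU) Cg; apply/Cn_mx => // i j.
apply: Cn_eq (Cn_sum (index_enum _) (P := xpredT) oU
  (fun k _ => CnM oU (Cf i k) (Cg k j))) => // x _.
by rewrite mxE.
Qed.

Lemma Cn_trmx {V} n (U : set V) a b (f : V -> 'M[R]_(a, b)) :
  open U -> Cn n U f -> Cn n U (fun x => (f x)^T).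
Proof.
move=> oU /(Cn_mx _ _ oU) Cf; apply/Cn_mx => // i j.
by apply: Cn_eq (Cf j i) => // x _; rewrite mxE.
Qed.

Lemma Cn_det {V} n (U : set V) a (f : V -> 'M[R]_a) :
  open U -> Cn n U f -> Cn n U (fun x => \det (f x) : R^o).
Proof.
move=> oU /(Cn_mx _ _ oU) Cf.
apply: Cn_sum => // s _; apply: CnM => //; first exact: Cn_cst.
by apply: Cn_prod => // i _; exact: Cf.
Qed.

(** Cramer's formula: each entry is a cofactor divided by the determinant, both polynomial in the
    entries of [f]. *)
Lemma Cn_invmx {V} n (U : set V) a (f : V -> 'M[R]_a) :
  open U -> (forall x, U x -> f x \in unitmx) -> Cn n U f ->
  Cn n U (fun x => invmx (f x)).
Proof.
move=> oU uf Cf; have /(Cn_mx _ _ oU) Ce := Cf; apply/Cn_mx => // i j.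
have Cd : Cn n U (fun x => (\det (f x))^-1 : R^o).
  apply: CnV => //; last exact: Cn_det.
  by move=> x /uf; rewrite unitmxE unitfE.
have Cc : Cn n U (fun x => cofactor (f x) j i : R^o).
  apply: CnM => //; first exact: Cn_cst.
  apply: Cn_det => //; apply/Cn_mx => // k l.
  by apply: Cn_eq (Ce (lift j k) (lift i l)) => // x _; rewrite !mxE.
apply: Cn_eq (CnM oU Cd Cc) => // x; rewrite inE => Ux.
by rewrite /invmx uf// !mxE.
Qed.

Lemma Cn_scale {V} n (U : set V) a b (k : V -> R^o) (f : V -> 'M[R]_(a, b)) :
  open U -> Cn n U k -> Cn n U f -> Cn n U (fun x => k x *: f x).
Proof.
move=> oU Ck /(Cn_mx _ _ oU) Cf; apply/Cn_mx => // i j.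
by apply: Cn_eq (CnM oU Ck (Cf i j)) => // x _; rewrite mxE.
Qed.

Lemma CnB {V W} n (U : set V) (f g : V -> W) :
  open U -> Cn n U f -> Cn n U g -> Cn n U (fun x => f x - g x).
Proof.
move=> oU Cf Cg; apply: CnD => //.
have cN : continuous (-%R : W -> W) by exact: opp_continuous.
exact: (@Cn_comp_linear _ _ _ _ n U g (-%R : {linear W -> W}) oU cN Cg).
Qed.

(** Linearity in the direction turns this into a sum of y_k D_{e_k} Z, so one order is lost on [Z]
    and none on [y]. The [e k] need not span [V]: on space-time they will be the spatial directions
    only. *)
Lemma Cn_derive_along {V} n (U : set V) m a b (e : 'I_m -> V) (y : V -> 'rV[R]_m)
    (Z : V -> 'M[R]_(a, b)) : open U -> Cn n U y -> Cn n.+1 U Z ->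
  Cn n U (fun u => 'D_(\sum_k y u 0 k *: e k) Z u).
Proof.
move=> oU /(Cn_mx _ _ oU) Cy CZ.
apply: Cn_eq (Cn_sum (index_enum _) (P := xpredT) oU
  (fun k _ => Cn_scale oU (Cy 0 k) (Cn_derive (e k) CZ))) => // x; rewrite inE => Ux.
have dZ := Cn_diff CZ Ux.
rewrite deriveE// linear_sum; apply: eq_bigr => k _.
by rewrite linearZ deriveE.
Qed.

(** As [h] has constant derivative, D_v (f o h) = (D_{l v} f) o h is again a composition with [h]
    and the induction closes at once. It serves the time slices and the projection of space-time
    onto space. *)
Lemma Cn_comp_affine {V V' W} n (U : set V) (U' : set V') (f : V' -> W)
    (h : V -> V') (l : V -> V') :
  open U -> (forall x, differentiable h x) -> (forall x v, 'D_v h x = l v) ->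
  (forall x, U x -> U' (h x)) -> Cn n U' f -> Cn n U (f \o h).
Proof.
move=> oU dh hl UU'; elim: n f => [|n IH] f Cf.
  by split=> // x Ux; apply: differentiable_comp => //; apply: Cn_diff Cf _; exact: UU'.
split=> [x Ux|v].
  by apply: differentiable_comp => //; apply: Cn_diff Cf _; exact: UU'.
apply: Cn_eq (IH _ (Cn_derive (l v) Cf)) => // x; rewrite inE => Ux /=.
have dfh := Cn_diff Cf (UU' _ Ux).
rewrite [RHS]deriveE; last exact: differentiable_comp.
by rewrite diff_comp//= !deriveE// -(hl x) deriveE.
Qed.

(** The chain rule in coordinates gives a sum of products D_v f_k * (D_k h o f), where the induction
    hypothesis applies to D_k h. *)
Lemma Cn_comp {V} n (U : set V) m (U' : set 'rV[R]_m) (f : V -> 'rV[R]_m)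
    (h : 'rV[R]_m -> R^o) : open U -> (forall x, U x -> U' (f x)) ->
  Cn n U f -> Cn n U' h -> Cn n U (h \o f : V -> R^o).
Proof.
move=> oU UU'; elim: n h => [|n IH] h Cf Ch.
  split=> // x Ux; apply: differentiable_comp; first exact: Cn_diff Cf Ux.
  by apply: Cn_diff Ch _; exact: UU'.
have dh x : U x -> differentiable h (f x) by move=> Ux; apply: Cn_diff Ch _; exact: UU'.
split=> [x Ux|v].
  by apply: differentiable_comp; [exact: Cn_diff Cf Ux|exact: dh].
have /(Cn_mx _ _ oU) CDf := Cn_derive v Cf.
apply: Cn_eq (Cn_sum (index_enum _) (P := xpredT) oU (fun k _ => CnM oU (CDf 0 k)
   (IH _ (Cn_pred Cf) (Cn_derive (delta_mx 0 k) Ch)))) => // x; rewrite inE => Ux /=.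
have dfx := Cn_diff Cf Ux.
have dhx := dh x Ux.
have dhf : differentiable (h \o f : V -> R^o) x.
  by apply: differentiable_comp; [exact: dfx|exact: dhx].
rewrite [RHS]deriveE//.
rewrite (diff_comp dfx dhx) /=.
rewrite -[X in 'd h _ X]deriveE// [X in 'd h _ X]row_sum_delta linear_sum.
by apply: eq_bigr => k _; rewrite linearZ [X in _ * X]deriveE.
Qed.

End SmoothMatrix.

(** * Symmetry of second derivatives *)

Section Schwarz.
Context {R : realType} {V : normedModType R}.

Lemma is_derive_line (W : normedModType R) (f : V -> W) (y v : V) (s : R) :
  differentiable f (y + s *: v) ->
  is_derive s 1 (fun s => f (y + s *: v)) ('D_v f (y + s *: v)).
Proof.
move=> df.
have dl : is_diff s (fun s : R => y + s *: v) ( *:%R ^~ v).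
  have := is_diffD (is_diff_cst y s) (is_diff_scalel s v).
  by rewrite add0r.
have dfl : differentiable (f \o (fun s : R => y + s *: v)) s.
  by apply: differentiable_comp.
apply: DeriveDef; first exact: diff_derivable.
rewrite deriveE// (@diff_comp _ _ _ _ (fun s : R => y + s *: v))//= diff_val/=.
by rewrite scale1r deriveE.
Qed.

Lemma MVT_line (f : V -> R^o) (y v : V) (h : R) : 0 < h ->
  (forall s, 0 <= s <= h -> differentiable f (y + s *: v)) ->
  exists2 s, 0 <= s <= h & f (y + h *: v) - f y = h * 'D_v f (y + s *: v).
Proof.
move=> h0 df.
have der s : 0 <= s <= h ->
    is_derive s 1 (fun s => f (y + s *: v)) ('D_v f (y + s *: v)).
  by move=> sh; apply: is_derive_line; exact: df.
have [||s] := @MVT R (fun s => f (y + s *: v)) (fun s => 'D_v f (y + s *: v)) 0 h h0.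
- by move=> s; rewrite in_itv /= => /andP[s0 sh]; apply: der; rewrite !ltW.
- apply: derivable_within_continuous => s; rewrite in_itv /= => /der dsf.
  exact: ex_derive.
rewrite in_itv /= => /andP[s0 sh]; rewrite scale0r addr0 subr0 => ->.
by exists s; rewrite ?(ltW s0) ?(ltW sh)// mulrC.
Qed.

(** The second difference is the increment along [v] of phi u = f (u + h w) - f u. The mean value
    theorem is used once for [phi] along [v], then once for D_v f along [w]. *)
Lemma second_difference (f : V -> R^o) (x v w : V) (h : R) : 0 < h ->
  (forall s t, 0 <= s <= h -> 0 <= t <= h -> differentiable f (x + s *: v + t *: w)) ->
  (forall s t, 0 <= s <= h -> 0 <= t <= h ->
     differentiable ('D_v f) (x + s *: v + t *: w)) ->
  exists s t, [/\ 0 <= s <= h, 0 <= t <= h &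
    f (x + h *: v + h *: w) - f (x + h *: v) - f (x + h *: w) + f x =
    h ^+ 2 * 'D_w ('D_v f) (x + s *: v + t *: w)].
Proof.
move=> h0 df dDf.
have hh : 0 <= h <= h by rewrite lexx (ltW h0).
have h00 : 0 <= (0 : R) <= h by rewrite lexx (ltW h0).
pose phi u := f (u + h *: w) - f u : R^o.
have shift u : is_diff u (fun u : V => u + h *: w) id.
  have := is_diffD (is_diff_id u) (is_diff_cst (h *: w) u).
  by rewrite addr0.
have d1 s : 0 <= s <= h -> differentiable (fun u => f (u + h *: w)) (x + s *: v).
  by move=> sh; apply: differentiable_comp => //; exact: df.
have d0 s : 0 <= s <= h -> differentiable f (x + s *: v).
  by move=> sh; have := df s 0 sh h00; rewrite scale0r addr0.
have dphi s : 0 <= s <= h -> differentiable phi (x + s *: v).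
  by move=> sh; apply: differentiableB; [exact: d1|exact: d0].
have [s sh /=] := MVT_line h0 dphi.
have -> : 'D_v phi (x + s *: v) =
    'D_v f (x + s *: v + h *: w) - 'D_v f (x + s *: v).
  have dd1 := d1 s sh.
  rewrite /phi deriveB; try by apply: diff_derivable; [exact: dd1 || exact: d0].
  congr (_ - _); rewrite [LHS]deriveE// (@diff_comp _ _ _ _ (fun u : V => u + h *: w))//=.
    by rewrite diff_val deriveE//; exact: df.
  exact: df.
have [t th ->] := @MVT_line ('D_v f) (x + s *: v) w h h0 (fun t th => dDf s t sh th).
rewrite /phi => E; exists s, t; split=> //.
by rewrite expr2 -mulrA -E; ring.
Qed.

Lemma near_box (x v w : V) (P : V -> Prop) : (\forall y \near x, P y) ->
  exists2 h : R, 0 < h &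
    forall s t, 0 <= s <= h -> 0 <= t <= h -> P (x + s *: v + t *: w).
Proof.
move=> /nbhs_ballP[r /= r0 rP].
have k0 : 0 < `|v| + `|w| + 1 by rewrite ltr_wpDl// addr_ge0.
(* The summand 1 keeps the denominator positive, and r / 2 leaves room for the strict inequality of
   the ball. *)
exists (r / 2 / (`|v| + `|w| + 1)); first by rewrite !divr_gt0.
move=> s t /andP[s0 sh] /andP[t0 th]; apply: rP.
rewrite -ball_normE /= -addrA opprD addNKr normrN.
apply: (@le_lt_trans _ _ (r / 2)); last by rewrite ltr_pdivrMr// mulr_natr mulr2n ltrDl.
apply: le_trans (ler_normD _ _) _; rewrite !normrZ (ger0_norm s0) (ger0_norm t0).
apply: (@le_trans _ _ (r / 2 / (`|v| + `|w| + 1) * (`|v| + `|w|))).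
  by rewrite mulrDr lerD// ler_wpM2r.
by rewrite mulrAC -mulrA ler_piMr ?divr_ge0 ?(ltW r0)// ler_pdivrMr// mul1r lerDl.
Qed.

(** The values are compared at two different points because the mean value theorem produces
    unrelated intermediate points for the two mixed derivatives. *)
Lemma continuous_eq_near (F G : V -> R^o) x :
  {for x, continuous F} -> {for x, continuous G} ->
  (forall P : V -> Prop, (\forall y \near x, P y) ->
     exists y z, [/\ P y, P z & F y = G z]) -> F x = G x.
Proof.
move=> cF cG FG; apply/eqP; rewrite -subr_eq0 -normr_le0.
apply/ler_addgt0Pl => _/posnumP[eps]; rewrite addr0.
have e2 : 0 < eps%:num / 2 by [].
have NF : \forall y \near x, `|F x - F y| < eps%:num / 2.
  by move/cvgrPdist_lt : cF; apply.
have NG : \forall y \near x, `|G x - G y| < eps%:num / 2.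
  by move/cvgrPdist_lt : cG; apply.
have [y [z [[Fy _] [_ Gz] FGyz]]] := FG _ (filterI NF NG).
rewrite -(subrKA (F y)) (le_trans (ler_normD _ _))// [leRHS]splitr.
by rewrite lerD// ?ltW// FGyz distrC.
Qed.

(** The second difference is symmetric in [v] and [w], hence equals h^2 times either mixed
    derivative, each at some point of the same small box; continuity concludes as the box
    shrinks. *)
Lemma derive_comm_scalar (U : set V) (f : V -> R^o) (x v w : V) :
  open U -> U x -> Cn 2 U f -> 'D_v ('D_w f) x = 'D_w ('D_v f) x.
Proof.
move=> oU Ux Cf.
have cont a b : {for x, continuous ('D_a ('D_b f))}.
  apply: differentiable_continuous.
  exact: Cn_diff (Cn_derive a (Cn_derive b Cf)) Ux.
apply: continuous_eq_near (cont v w) (cont w v) _ => P xP.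
have [h h0 hP] := near_box v w (filterI (open_nbhs_nbhs (conj oU Ux)) xP).
have [s [t [sh th]]] : exists s t, [/\ 0 <= s <= h, 0 <= t <= h &
    f (x + h *: v + h *: w) - f (x + h *: v) - f (x + h *: w) + f x =
    h ^+ 2 * 'D_w ('D_v f) (x + s *: v + t *: w)].
  apply: second_difference => // a b ah bh; have [Uab _] := hP _ _ ah bh.
    exact: Cn_diff Cf Uab.
  exact: Cn_diff (Cn_derive v Cf) Uab.
have [t' [s' [th' sh']]] : exists t s, [/\ 0 <= t <= h, 0 <= s <= h &
    f (x + h *: w + h *: v) - f (x + h *: w) - f (x + h *: v) + f x =
    h ^+ 2 * 'D_v ('D_w f) (x + t *: w + s *: v)].
  apply: second_difference => // a b ah bh; have [Uab _] := hP _ _ bh ah.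
    by rewrite addrAC; exact: Cn_diff Cf Uab.
  by rewrite addrAC; exact: Cn_diff (Cn_derive w Cf) Uab.
have h2 : h ^+ 2 != 0 by rewrite expf_neq0// gt_eqF.
have [[_ P1] [_ P2]] := (hP _ _ sh th, hP _ _ sh' th').
rewrite (addrAC x (h *: w)) (addrAC x (t' *: w)) => E2 E1.
exists (x + s' *: v + t' *: w), (x + s *: v + t *: w); split; [exact: P2|exact: P1|].
apply: (mulfI h2); rewrite -[LHS]E2 -[RHS]E1.
by rewrite [in LHS](addrAC (f _)).
Qed.

Lemma derive_comm a b (U : set V) (f : V -> 'M[R]_(a, b)) (x v w : V) :
  open U -> U x -> Cn 2 U f -> 'D_v ('D_w f) x = 'D_w ('D_v f) x.
Proof.
move=> oU Ux Cf; apply/matrixP => i j.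
have /(Cn_mx _ _ oU)/(_ i j) Cij := Cf.
have E p q : 'D_p ('D_q f) x i j = 'D_p ('D_q (fun y => f y i j : R^o)) x.
  rewrite -derive_entry; last exact: Cn_diff (Cn_derive q Cf) Ux.
  apply: (derive_eq_on _ oU) => // y; rewrite inE => Uy.
  by rewrite derive_entry//; exact: Cn_diff Cf Uy.
exact: (etrans (E v w) (etrans (derive_comm_scalar v w oU Ux Cij) (esym (E w v)))).
Qed.

(* If [e] is the canonical basis then the direction is the field [y] itself; on
   [R^o * 'rV_m] we also use [e k = (0, delta_mx 0 k)]. *)
Lemma derive_derive_along m a b (U : set V) (e : 'I_m -> V) (y : V -> 'rV[R]_m)
    (Z : V -> 'M[R]_(a, b)) (x v : V) : open U -> U x -> Cn 1 U y -> Cn 2 U Z ->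
  'D_v (fun u => 'D_(\sum_k y u 0 k *: e k) Z u) x =
  'D_(\sum_k ('D_v y x) 0 k *: e k) Z x + 'D_v ('D_(\sum_k y x 0 k *: e k) Z) x.
Proof.
move=> oU Ux Cy CZ.
have along (c : 'rV[R]_m) u : U u -> 'D_(\sum_k c 0 k *: e k) Z u =
    \sum_k c 0 k *: 'D_(e k) Z u.
  move=> Uu; have dZ := Cn_diff CZ Uu.
  rewrite deriveE// linear_sum; apply: eq_bigr => k _.
  by rewrite linearZ deriveE.
rewrite (@derive_eq_on _ _ _ U _
  (\sum_k (fun u => y u 0 k *: 'D_(e k) Z u)) x v oU _ Ux); last first.
  by move=> u; rewrite inE => Uu; rewrite along// fct_sumE.
rewrite (@derive_eq_on _ _ _ U ('D_(\sum_k y x 0 k *: e k) Z)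
  (\sum_k (fun u => y x 0 k *: 'D_(e k) Z u)) x v oU _ Ux); last first.
  by move=> u; rewrite inE => Uu; rewrite along// fct_sumE.
have dDZ k : differentiable ('D_(e k) Z) x by exact: Cn_diff (Cn_derive _ CZ) Ux.
have dy k : differentiable (fun u => y u 0 k : R^o) x.
  by apply: differentiable_entry; exact: Cn_diff Cy Ux.
have dp k : differentiable (fun u => y u 0 k *: 'D_(e k) Z u) x.
  apply: differentiable_mx => i j.
  rewrite (_ : (fun _ => _) = (fun u => y u 0 k * 'D_(e k) Z u i j : R^o)).
    by apply: differentiableM => //; exact: differentiable_entry.
  by apply/funext => u; rewrite mxE.
rewrite derive_sum; last by move=> k; exact: diff_derivable.
rewrite derive_sum; last by move=> k; apply: derivableZ; exact: diff_derivable.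
rewrite along// -big_split /=; apply: eq_bigr => k _.
rewrite deriveZ; last exact: diff_derivable.
apply/matrixP => i j; rewrite -derive_entry; last exact: dp.
rewrite [RHS]mxE [X in X + _]mxE [X in _ + X]mxE.
rewrite (_ : (fun _ => _) = (fun u => y u 0 k : R^o) * (fun u => 'D_(e k) Z u i j : R^o)).
  rewrite [LHS]deriveM; try by apply: diff_derivable => //; exact: differentiable_entry.
  rewrite !derive_entry//; last exact: Cn_diff Cy Ux.
  by rewrite addrC; congr (_ + _); exact: mulrC.
by apply/funext => u; rewrite mxE.
Qed.

End Schwarz.

(** * The Levi-Civita connection in coordinates *)

Section Inner.
Context {R : realType} {m : nat}.
Implicit Types (G : 'M[R]_m) (v w : 'rV[R]_m).

Lemma innerDl G v v' w : inner G (v + v') w = inner G v w + inner G v' w.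
Proof. by rewrite /inner !mulmxDl mxE. Qed.

Lemma innerDr G v w w' : inner G v (w + w') = inner G v w + inner G v w'.
Proof. by rewrite /inner linearD /= mulmxDr mxE. Qed.

Lemma innerZl G a v w : inner G (a *: v) w = a * inner G v w.
Proof. by rewrite /inner -!scalemxAl mxE. Qed.

Lemma innerZr G a v w : inner G v (a *: w) = a * inner G v w.
Proof. by rewrite /inner linearZ /= -scalemxAr mxE. Qed.

Lemma innerNl G v w : inner G (- v) w = - inner G v w.
Proof. by rewrite -scaleN1r innerZl mulN1r. Qed.

Lemma innerNr G v w : inner G v (- w) = - inner G v w.
Proof. by rewrite -scaleN1r innerZr mulN1r. Qed.

Lemma innerBl G v v' w : inner G (v - v') w = inner G v w - inner G v' w.
Proof. by rewrite innerDl innerNl. Qed.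

Lemma innerBr G v w w' : inner G v (w - w') = inner G v w - inner G v w'.
Proof. by rewrite innerDr innerNr. Qed.

Lemma inner0l G w : inner G 0 w = 0.
Proof. by rewrite /inner !mul0mx mxE. Qed.

Lemma inner0r G v : inner G v 0 = 0.
Proof. by rewrite /inner trmx0 mulmx0 mxE. Qed.

Lemma inner_suml G w (I : Type) (r : seq I) (F : I -> 'rV[R]_m) :
  inner G (\sum_(i <- r) F i) w = \sum_(i <- r) inner G (F i) w.
Proof. by elim/big_ind2: _ => [|_ a _ b <- <-|//]; rewrite ?inner0l ?innerDl. Qed.

Lemma inner_sumr G v (I : Type) (r : seq I) (F : I -> 'rV[R]_m) :
  inner G v (\sum_(i <- r) F i) = \sum_(i <- r) inner G v (F i).
Proof. by elim/big_ind2: _ => [|_ a _ b <- <-|//]; rewrite ?inner0r ?innerDr. Qed.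

Lemma innerC G v w : G^T = G -> inner G v w = inner G w v.
Proof.
by move=> GT; rewrite /inner -[v *m G *m w^T]trmxK mxE !trmx_mul trmxK GT mulmxA.
Qed.

Lemma innerE G v w : inner G v w = \sum_i \sum_j v 0 i * w 0 j * G i j.
Proof.
rewrite /inner mxE; under eq_bigr => j _ do rewrite !mxE mulr_suml.
rewrite exchange_big; apply: eq_bigr => i _; apply: eq_bigr => j _.
by rewrite mulrAC.
Qed.

Lemma innerM0 v w : inner 0 v w = 0.
Proof. by rewrite /inner mulmx0 mul0mx mxE. Qed.

End Inner.

(** * Product rules for matrices and inner products *)

Section DeriveInner.
Context {R : realType} {V : normedModType R}.

Lemma differentiable_mulmx a b c (f : V -> 'M[R]_(a, b)) (g : V -> 'M[R]_(b, c)) x :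
  differentiable f x -> differentiable g x -> differentiable (fun u => f u *m g u) x.
Proof.
move=> df dg; apply: differentiable_mx => i j.
rewrite (_ : (fun _ => _) =
    \sum_k (fun u => f u i k : R^o) * (fun u => g u k j : R^o) :> (V -> R^o)); last first.
  by apply/funext => u; rewrite fct_sumE mxE.
apply: differentiable_sum => k; apply: differentiableM; exact: differentiable_entry.
Qed.

Lemma derive_mulmx a b c (f : V -> 'M[R]_(a, b)) (g : V -> 'M[R]_(b, c)) x v :
  differentiable f x -> differentiable g x ->
  'D_v (fun u => f u *m g u) x = 'D_v f x *m g x + f x *m 'D_v g x.
Proof.
move=> df dg; apply/matrixP => i j.
rewrite -derive_entry; last exact: differentiable_mulmx.
rewrite (_ : (fun _ => _) =
    \sum_k (fun u => f u i k : R^o) * (fun u => g u k j : R^o) :> (V -> R^o)); last first.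
  by apply/funext => u; rewrite fct_sumE mxE.
have dfe k : derivable (fun u => f u i k : R^o) x v.
  by apply: diff_derivable; exact: differentiable_entry.
have dge k : derivable (fun u => g u k j : R^o) x v.
  by apply: diff_derivable; exact: differentiable_entry.
rewrite derive_sum; last by move=> k; exact: derivableM.
rewrite !mxE -big_split /=; apply: eq_bigr => k _.
rewrite deriveM; [|exact: dfe|exact: dge].
rewrite (derive_entry _ _ _ df) (derive_entry _ _ _ dg).
by rewrite addrC; congr (_ + _); exact: mulrC.
Qed.

Lemma differentiable_trmx a b (f : V -> 'M[R]_(a, b)) x :
  differentiable f x -> differentiable (fun u => (f u)^T) x.
Proof.
move=> df; apply: differentiable_mx => i j.
rewrite (_ : (fun _ => _) = (fun u => f u j i : R^o)); first exact: differentiable_entry.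
by apply/funext => u; rewrite mxE.
Qed.

Lemma derive_trmx a b (f : V -> 'M[R]_(a, b)) x v :
  differentiable f x -> 'D_v (fun u => (f u)^T) x = ('D_v f x)^T.
Proof.
move=> df; apply/matrixP => i j.
rewrite -derive_entry; last exact: differentiable_trmx.
rewrite [RHS]mxE -[RHS]derive_entry; last exact: df.
by congr ('D_v _ x); apply/funext => u; rewrite mxE.
Qed.

Lemma differentiable_inner m (G : V -> 'M[R]_m) (X Y : V -> 'rV[R]_m) x :
  differentiable G x -> differentiable X x -> differentiable Y x ->
  differentiable (fun u => inner (G u) (X u) (Y u) : R^o) x.
Proof.
move=> dG dX dY; apply: (differentiable_entry 0 0).
apply: differentiable_mulmx; first exact: differentiable_mulmx.
exact: differentiable_trmx.
Qed.

Lemma derive_inner m (G : V -> 'M[R]_m) (X Y : V -> 'rV[R]_m) x v :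
  differentiable G x -> differentiable X x -> differentiable Y x ->
  'D_v (fun u => inner (G u) (X u) (Y u) : R^o) x =
  inner ('D_v G x) (X x) (Y x) + inner (G x) ('D_v X x) (Y x)
  + inner (G x) (X x) ('D_v Y x).
Proof.
move=> dG dX dY.
have dXG : differentiable (fun u => X u *m G u) x by exact: differentiable_mulmx.
have dYT : differentiable (fun u => (Y u)^T) x by exact: differentiable_trmx.
rewrite [LHS]derive_entry; last exact: differentiable_mulmx.
rewrite derive_mulmx; [|exact: dXG|exact: dYT].
rewrite derive_mulmx; [|exact: dX|exact: dG].
rewrite derive_trmx; last exact: dY.
by rewrite mulmxDl /inner !mxE [X in X + _]addrC.
Qed.

Lemma derive_linear_dir (W : normedModType R) (f : V -> W) x (I : finType) (c : I -> R) (e : I -> V) :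
  differentiable f x ->
  'D_(\sum_k c k *: e k) f x = \sum_k c k *: 'D_(e k) f x.
Proof.
move=> df; rewrite deriveE; last exact: df.
rewrite linear_sum; apply: eq_bigr => k _.
by rewrite linearZ -deriveE.
Qed.

Lemma derive_dirD (W : normedModType R) (f : V -> W) x v w :
  differentiable f x -> 'D_(v + w) f x = 'D_v f x + 'D_w f x.
Proof. by move=> df; rewrite !deriveE// linearD. Qed.

Lemma derive_dirB (W : normedModType R) (f : V -> W) x v w :
  differentiable f x -> 'D_(v - w) f x = 'D_v f x - 'D_w f x.
Proof. by move=> df; rewrite !deriveE// linearB. Qed.

Lemma derive_dirZ (W : normedModType R) (f : V -> W) x a v :
  differentiable f x -> 'D_(a *: v) f x = a *: 'D_v f x.
Proof. by move=> df; rewrite !deriveE// linearZ. Qed.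

Lemma derive_comp (V' W : normedModType R) (f : V -> V') (h : V' -> W) x v :
  differentiable f x -> differentiable h (f x) ->
  'D_v (h \o f) x = 'D_('D_v f x) h (f x).
Proof.
move=> df dh; rewrite deriveE; last exact: differentiable_comp.
by rewrite (diff_comp df dh) /= -deriveE// -deriveE.
Qed.

End DeriveInner.

(** * Covariant derivative, curvature and Koszul's formula *)

Section LocalGeometry.
Context {R : realType} {m : nat}.
Implicit Types (X Y Z : 'rV[R]_m -> 'rV[R]_m) (a b c u : 'rV[R]_m).

Definition bracket {q} (X Y : 'rV[R]_q -> 'rV[R]_q) (u : 'rV[R]_q) : 'rV[R]_q :=
  'D_(X u) Y u - 'D_(Y u) X u.

(** The shape of the Christoffel term of a covariant derivative, and of its derivatives; it keeps
    the curvature computation free of indices. *)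
Definition bilin (C : 'I_m -> 'M[R]_m) a b : 'rV[R]_m := \row_k inner (C k) a b.

Lemma bilinDl C a a' b : bilin C (a + a') b = bilin C a b + bilin C a' b.
Proof. by apply/rowP => k; rewrite !mxE innerDl. Qed.

Lemma bilinDr C a b b' : bilin C a (b + b') = bilin C a b + bilin C a b'.
Proof. by apply/rowP => k; rewrite !mxE innerDr. Qed.

Lemma bilinBl C a a' b : bilin C (a - a') b = bilin C a b - bilin C a' b.
Proof. by apply/rowP => k; rewrite !mxE innerBl. Qed.

Lemma bilinC C a b : (forall k, (C k)^T = C k) -> bilin C a b = bilin C b a.
Proof. by move=> CT; apply/rowP => k; rewrite !mxE innerC. Qed.

Lemma inner_comb (P : 'I_m -> 'M[R]_m) a b c :
  inner (\sum_i a 0 i *: P i) b c =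
  \sum_i \sum_j \sum_l a 0 i * b 0 j * c 0 l * P i j l.
Proof.
rewrite /inner mulmx_sumr mulmx_suml summxE; apply: eq_bigr => i _.
rewrite -scalemxAr -scalemxAl mxE -/(inner _ b c) innerE mulr_sumr.
apply: eq_bigr => j _; rewrite mulr_sumr; apply: eq_bigr => l _; ring.
Qed.

(** Here P i j l stands for the partial derivative d_i g_jl, [gi] for the inverse of [g] and [C] for
    the Christoffel symbols; lowering the upper index with [g] cancels [gi]. The lemma is stated on
    plain matrices to separate the index algebra from analysis. *)
Lemma first_kind_algebra (P : 'I_m -> 'M[R]_m) (g gi : 'M[R]_m) (C : 'I_m -> 'M[R]_m) a b c :
  gi *m g = 1%:M -> gi^T = gi ->
  (forall i j k, C k i j = 2^-1 * \sum_l gi k l * (P i j l + P j i l - P l i j)) ->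
  inner g (bilin C a b) c =
  2^-1 * (inner (\sum_i a 0 i *: P i) b c + inner (\sum_i b 0 i *: P i) a c
          - inner (\sum_i c 0 i *: P i) a b).
Proof.
move=> gig giT CE.
pose K i j l := 2^-1 * (P i j l + P j i l - P l i j).
pose T : 'rV[R]_m := \row_l \sum_i \sum_j a 0 i * b 0 j * K i j l.
have -> : bilin C a b = T *m gi.
  apply/rowP => k; rewrite mxE innerE [RHS]mxE.
  transitivity (\sum_l \sum_i \sum_j a 0 i * b 0 j * K i j l * gi k l).
    rewrite [RHS]exchange_big; apply: eq_bigr => i _ /=.
    rewrite [RHS]exchange_big; apply: eq_bigr => j _ /=.
    rewrite CE !mulr_sumr; apply: eq_bigr => l _; rewrite /K; ring.
  apply: eq_bigr => l _; rewrite mxE mulr_suml; apply: eq_bigr => i _.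
  rewrite mulr_suml; apply: eq_bigr => j _; congr (_ * _).
  by rewrite -[in LHS]giT mxE.
rewrite /inner -(mulmxA T) gig mulmx1 -!/(inner _ _ _) !inner_comb mxE.
(* The three sums are permuted until the index of [a] is outermost, then that of [b], then that of
   [c]. *)
rewrite [X in _ + X - _]exchange_big /=.
under [X in _ - X]eq_bigr => l _ do rewrite exchange_big /=.
rewrite [X in _ - X]exchange_big /=.
under [X in _ - X]eq_bigr => j _ do rewrite exchange_big /=.
rewrite [X in _ - X]exchange_big /=.
rewrite -big_split -sumrB mulr_sumr /=.
under eq_bigr => l _ do rewrite !mxE mulr_suml.
rewrite exchange_big; apply: eq_bigr => i _ /=.
under eq_bigr => l _ do rewrite mulr_suml.
rewrite exchange_big /= -big_split -sumrB mulr_sumr; apply: eq_bigr => j _ /=.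
rewrite -big_split -sumrB mulr_sumr; apply: eq_bigr => l _ /=.
rewrite /K; ring.
Qed.

Variables (G : 'rV[R]_m -> 'M[R]_m) (U : set 'rV[R]_m).
Hypotheses (oU : open U) (sG : forall n, Cn n U G).
Hypotheses (GT : forall u, U u -> (G u)^T = G u) (Gu : forall u, U u -> G u \in unitmx).

Definition christoffel_mx (u : 'rV[R]_m) (k : 'I_m) : 'M[R]_m :=
  \matrix_(i, j) christoffel G i j k u.

Lemma covDE X Y u : covD G X Y u = 'D_(X u) Y u + bilin (christoffel_mx u) (X u) (Y u).
Proof.
congr (_ + _); apply/rowP => k; rewrite !mxE innerE.
by apply: eq_bigr => i _; apply: eq_bigr => j _; rewrite mxE.
Qed.

Let dG u : U u -> differentiable G u.
Proof. exact: Cn_diff (sG 0). Qed.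

Lemma partial_entry i k l u : U u -> partial i (fun w => G w k l) u = 'D_(delta_mx 0 i) G u k l.
Proof. by move=> Uu; rewrite /partial derive_entry//; exact: dG. Qed.

Lemma christoffel_sym u k : U u -> (christoffel_mx u k)^T = christoffel_mx u k.
Proof.
move=> Uu; apply/matrixP => i j; rewrite !mxE; congr (_ * _).
apply: eq_bigr => l _; congr (_ * _); rewrite [X in X - _]addrC; congr (_ - _).
rewrite !partial_entry// -[in LHS]derive_entry; last exact: dG.
rewrite -[in RHS]derive_entry; last exact: dG.
apply: (derive_eq_on _ oU) => // w; rewrite inE => Uw.
by rewrite -[in LHS](GT Uw) mxE.
Qed.

Lemma Cn_christoffel_mx n k : Cn n U (fun u => christoffel_mx u k).
Proof.
apply/Cn_mx => // i j.
have Cp i' k' l : Cn n U (partial i' (fun w => G w k' l) : _ -> R^o).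
  have /(Cn_mx _ _ oU)/(_ k' l) := sG n.+1.
  exact: Cn_derive.
have /(Cn_mx _ _ oU) Ci : Cn n U (fun u => invmx (G u)) by exact: Cn_invmx.
apply: (Cn_eq oU (f := fun u => 2^-1 * \sum_l invmx (G u) k l *
    (partial i (fun w => G w j l) u + partial j (fun w => G w i l) u
     - partial l (fun w => G w i j) u) : R^o)).
  by move=> u _; rewrite mxE.
apply: CnM => //; first exact: Cn_cst.
apply: Cn_sum => // l _; apply: CnM => //.
by apply: CnB => //; exact: CnD.
Qed.

Lemma Cn_bilin n (C : 'rV[R]_m -> 'I_m -> 'M[R]_m) X Y :
  (forall k, Cn n U (fun u => C u k)) -> Cn n U X -> Cn n U Y ->
  Cn n U (fun u => bilin (C u) (X u) (Y u)).
Proof.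
move=> CC CX CY; apply/Cn_mx => // i k.
apply: (Cn_eq oU (f := fun u => inner (C u k) (X u) (Y u) : R^o)).
  by move=> u _; rewrite mxE.
have : Cn n U (fun u => X u *m C u k *m (Y u)^T).
  by apply: Cn_mulmx => //; [exact: Cn_mulmx|exact: Cn_trmx].
by move/(Cn_mx _ _ oU)/(_ 0 0).
Qed.

Lemma Cn_derive_field n q (y : 'rV[R]_m -> 'rV[R]_m) (Z : 'rV[R]_m -> 'rV[R]_q) :
  Cn n U y -> Cn n.+1 U Z -> Cn n U (fun u => 'D_(y u) Z u).
Proof.
move=> Cy CZ; have := Cn_derive_along (fun k => delta_mx 0 k) oU Cy CZ.
rewrite (_ : (fun u => 'D_(y u) Z u) =
  (fun u => 'D_(\sum_k y u 0 k *: delta_mx 0 k) Z u)); first exact: id.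
by apply/funext => u; rewrite [in LHS](row_sum_delta (y u)).
Qed.

Lemma Cn_covD n X Y : Cn n U X -> Cn n.+1 U Y -> Cn n U (covD G X Y).
Proof.
move=> CX CY.
apply: (Cn_eq oU (f := fun u => 'D_(X u) Y u + bilin (christoffel_mx u) (X u) (Y u))).
  by move=> u _; rewrite covDE.
apply: CnD => //; first exact: Cn_derive_field.
by apply: Cn_bilin => //; [exact: Cn_christoffel_mx|exact: Cn_pred].
Qed.

Lemma derive_derive_field q (y : 'rV[R]_m -> 'rV[R]_m) (Z : 'rV[R]_m -> 'rV[R]_q) u a :
  U u -> Cn 1 U y -> Cn 2 U Z ->
  'D_a (fun w => 'D_(y w) Z w) u = 'D_('D_a y u) Z u + 'D_a ('D_(y u) Z) u.
Proof.
move=> Uu Cy CZ.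
have := @derive_derive_along R _ m 1 q U (fun k => delta_mx 0 k) y Z u a oU Uu Cy CZ.
rewrite -[\sum_k ('D_a y u) 0 k *: _]row_sum_delta -[\sum_k (y u) 0 k *: _]row_sum_delta.
move=> <-; congr ('D_a _ u); apply/funext => w.
by rewrite [in LHS](row_sum_delta (y w)).
Qed.

Lemma derive_bilin (C : 'rV[R]_m -> 'I_m -> 'M[R]_m) X Y u a :
  (forall k, differentiable (fun u => C u k) u) -> differentiable X u -> differentiable Y u ->
  'D_a (fun w => bilin (C w) (X w) (Y w)) u =
  bilin (fun k => 'D_a (fun w => C w k) u) (X u) (Y u)
  + bilin (C u) ('D_a X u) (Y u) + bilin (C u) (X u) ('D_a Y u).
Proof.
move=> dC dX dY.
have entryE i k : (fun w => bilin (C w) (X w) (Y w) i k : R^o) =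
    (fun w => inner (C w k) (X w) (Y w) : R^o).
  by apply/funext => w; rewrite mxE.
apply/rowP => k; rewrite -derive_entry; last first.
  apply: differentiable_mx => i' k'; rewrite entryE.
  exact: (differentiable_inner (dC _) dX dY).
rewrite entryE (derive_inner _ (dC _) dX dY).
by rewrite !mxE.
Qed.

Lemma derive_covD X Y u a : U u -> Cn 1 U X -> Cn 2 U Y ->
  'D_a (covD G X Y) u =
  'D_('D_a X u) Y u + 'D_a ('D_(X u) Y) u
  + (bilin (fun k => 'D_a (fun w => christoffel_mx w k) u) (X u) (Y u)
     + bilin (christoffel_mx u) ('D_a X u) (Y u)
     + bilin (christoffel_mx u) (X u) ('D_a Y u)).
Proof.
move=> Uu CX CY.
have dX := Cn_diff CX Uu; have dY := Cn_diff CY Uu.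
have dC k : differentiable (fun w => christoffel_mx w k) u.
  exact: Cn_diff (Cn_christoffel_mx 0 k) Uu.
rewrite (_ : covD G X Y = (fun w => 'D_(X w) Y w) +
    (fun w => bilin (christoffel_mx w) (X w) (Y w))); last first.
  by apply/funext => w; rewrite covDE.
rewrite deriveD; first 1 last.
- apply: diff_derivable; apply: Cn_diff (Cn_derive_field _ CY) Uu.
  exact: CX.
- apply: diff_derivable; apply: Cn_diff (Cn_bilin (Cn_christoffel_mx 1) CX (Cn_pred CY)) Uu.
rewrite (derive_derive_field _ Uu CX CY) derive_bilin; [|exact: dC|exact: dX|exact: dY].
by [].
Qed.

(** The letters stand for the terms of R(X, Y)Z: dxy is D_X Y and so on, e1 and e2 are the
    derivatives of Z along dxy and dyx, b1 and b2 those of the Christoffel symbols along X and Y.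
    The second derivative s of Z is shared by both orders, thanks to Schwarz. *)
Lemma bilin_curvature_algebra C x y z dxy dyx dxz dyz s e1 e2 b1 b2 :
  let Gam := bilin C in
  (e1 + s + (b1 + Gam dxy z + Gam y dxz) + Gam x (dyz + Gam y z))
  - (e2 + s + (b2 + Gam dyx z + Gam x dyz) + Gam y (dxz + Gam x z))
  - (e1 - e2 + Gam (dxy - dyx) z)
  = b1 - b2 + Gam x (Gam y z) - Gam y (Gam x z).
Proof.
move=> Gam; rewrite /Gam !bilinDr bilinBl -/Gam.
move: (Gam dxy z) (Gam dyx z) (Gam y dxz) (Gam x dyz) => ? ? ? ?.
move: (Gam x (Gam _ _)) (Gam y (Gam _ _)) => ? ?.
apply/rowP => k; rewrite !mxE; ring.
Qed.

(** All derivatives of the three fields cancel; only their values at [u] survive, which is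
    tensoriality. *)
Lemma curv_pointwise X Y Z u : U u -> Cn 2 U X -> Cn 2 U Y -> Cn 2 U Z ->
  let D a k := 'D_a (fun w => christoffel_mx w k) u in
  let Gam := bilin (christoffel_mx u) in
  curv G X Y Z u =
  bilin (D (X u)) (Y u) (Z u) - bilin (D (Y u)) (X u) (Z u)
  + Gam (X u) (Gam (Y u) (Z u)) - Gam (Y u) (Gam (X u) (Z u)).
Proof.
move=> Uu CX CY CZ D Gam.
have dZ := Cn_diff CZ Uu.
rewrite /curv 3!covDE.
rewrite (derive_covD _ Uu (Cn_pred CY) CZ) (derive_covD _ Uu (Cn_pred CX) CZ).
rewrite !covDE derive_dirB; last exact: dZ.
rewrite (derive_comm (Y u) (X u) oU Uu CZ).
exact: bilin_curvature_algebra.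
Qed.

Lemma curv_tensorial X Y Z u : U u -> Cn 2 U X -> Cn 2 U Y -> Cn 2 U Z ->
  curv G X Y Z u = curv G (fun=> X u) (fun=> Y u) (fun=> Z u) u.
Proof.
move=> Uu CX CY CZ.
rewrite (curv_pointwise Uu CX CY CZ).
by rewrite (curv_pointwise Uu (Cn_cst _ _ _) (Cn_cst _ _ _) (Cn_cst _ _ _)).
Qed.

Lemma christoffel_first_kind u a b c : U u ->
  inner (G u) (bilin (christoffel_mx u) a b) c =
  2^-1 * (inner ('D_a G u) b c + inner ('D_b G u) a c - inner ('D_c G u) a b).
Proof.
move=> Uu.
have DE v : 'D_v G u = \sum_i v 0 i *: 'D_(delta_mx 0 i) G u.
  by rewrite [in LHS](row_sum_delta v) derive_linear_dir//; exact: dG.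
rewrite (DE a) (DE b) (DE c).
apply: (@first_kind_algebra (fun i => 'D_(delta_mx 0 i) G u) _ (invmx (G u))).
- by rewrite mulVmx ?Gu.
- by rewrite trmx_inv GT.
move=> i j k; rewrite mxE; congr (_ * _); apply: eq_bigr => l _; congr (_ * _).
by rewrite !partial_entry.
Qed.

Lemma covD_metric X Y Z u : U u -> Cn 1 U Y -> Cn 1 U Z ->
  'D_(X u) (fun w => inner (G w) (Y w) (Z w) : R^o) u =
  inner (G u) (covD G X Y u) (Z u) + inner (G u) (Y u) (covD G X Z u).
Proof.
move=> Uu CY CZ.
rewrite derive_inner; [|exact: dG|exact: Cn_diff CY Uu|exact: Cn_diff CZ Uu].
have DT v : ('D_v G u)^T = 'D_v G u.
  rewrite -derive_trmx; last exact: dG.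
  by apply: (derive_eq_on _ oU) => // w; rewrite inE => /GT.
rewrite !covDE innerDl innerDr christoffel_first_kind//.
rewrite (innerC (Y u) (bilin _ _ _) (GT Uu)) christoffel_first_kind//.
(* The two first-kind expressions differ by exchanging Y and Z: dY and dZ cancel in the sum, and the
   two halves of the derivative of the metric along X add up. *)
have half (p q d d' dY dZ : R) : d' = d ->
    d + p + q = p + 2^-1 * (d + dY - dZ) + (q + 2^-1 * (d' + dZ - dY)).
  by move=> ->; lra.
apply: half; exact: innerC (DT _).
Qed.

Lemma covD_torsion X Y u : U u ->
  covD G X Y u - covD G Y X u = bracket X Y u.
Proof.
move=> Uu; rewrite !covDE (bilinC (Y u)); last by move=> k; exact: christoffel_sym.
by rewrite /bracket opprD addrACA subrr addr0.
Qed.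

(** Metric compatibility expands the three derivatives and the vanishing torsion the three brackets;
    the rest is linear arithmetic. *)
Lemma koszul X Y Z u : U u -> Cn 1 U X -> Cn 1 U Y -> Cn 1 U Z ->
  2 * inner (G u) (covD G X Y u) (Z u) =
  'D_(X u) (fun w => inner (G w) (Y w) (Z w) : R^o) u
  + 'D_(Y u) (fun w => inner (G w) (Z w) (X w) : R^o) u
  - 'D_(Z u) (fun w => inner (G w) (X w) (Y w) : R^o) u
  + inner (G u) (bracket X Y u) (Z u) - inner (G u) (bracket X Z u) (Y u)
  - inner (G u) (bracket Y Z u) (X u).
Proof.
move=> Uu CX CY CZ; rewrite !covD_metric// -!covD_torsion// !innerBl.
have C v w := innerC v w (GT Uu).
rewrite (C (Y u)) (C (Z u) (covD _ _ _ _)) (C (X u) (covD _ _ _ _)).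
lra.
Qed.

End LocalGeometry.

(** * O'Neill's formula *)

Section ONeill.
Context {R : realType} {m p : nat}.
Variables (U : set 'rV[R]_m) (G : 'rV[R]_m -> 'M[R]_m).
Hypotheses (oU : open U) (sG : forall n, Cn n U G).
Hypotheses (GT : forall u, U u -> (G u)^T = G u).
Hypotheses (Gpos : forall u v, U u -> v != 0 -> 0 < inner (G u) v v).
Variables (Y : set 'rV[R]_p) (Phi : 'rV[R]_m -> 'rV[R]_p).
Hypotheses (sPhi : forall n, Cn n U Phi) (PhiY : forall u, U u -> Y (Phi u)).

Lemma posdef_unitmx (H : 'M[R]_m) : (forall v, v != 0 -> 0 < inner H v v) -> H \in unitmx.
Proof.
move=> Hpos; rewrite -row_free_unit -kermx_eq0; apply/rowV0P => v /sub_kermxP vH.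
apply/eqP; apply/negPn/negP => /Hpos.
by rewrite /inner vH mul0mx mxE ltxx.
Qed.

Let Gu u : U u -> G u \in unitmx.
Proof. by move=> Uu; apply: posdef_unitmx => v; exact: Gpos. Qed.

Let dPhi u : U u -> differentiable Phi u.
Proof. exact: Cn_diff (sPhi 0). Qed.

(** Differentiating D_Z Phi = z o Phi along X produces D_{D_X Z} Phi plus a second derivative of
    Phi. The latter is symmetric in X and Z and disappears from the bracket. *)
Lemma bracket_related (X Z : 'rV[R]_m -> 'rV[R]_m) (x z : 'rV[R]_p -> 'rV[R]_p) u :
  U u -> Cn 1 U X -> Cn 1 U Z -> Cn 0 Y x -> Cn 0 Y z ->
  (forall w, U w -> 'D_(X w) Phi w = x (Phi w)) ->
  (forall w, U w -> 'D_(Z w) Phi w = z (Phi w)) ->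
  'D_(bracket X Z u) Phi u = bracket x z (Phi u).
Proof.
move=> Uu CX CZ Cx Cz Xx Zz.
have half (X1 Z1 : 'rV[R]_m -> 'rV[R]_m) (x1 z1 : 'rV[R]_p -> 'rV[R]_p) :
    Cn 1 U Z1 -> Cn 0 Y z1 ->
    (forall w, U w -> 'D_(X1 w) Phi w = x1 (Phi w)) ->
    (forall w, U w -> 'D_(Z1 w) Phi w = z1 (Phi w)) ->
    'D_('D_(X1 u) Z1 u) Phi u =
      'D_(x1 (Phi u)) z1 (Phi u) - 'D_(X1 u) ('D_(Z1 u) Phi) u.
  move=> CZ1 Cz1 Xx1 Zz1; apply/eqP; rewrite -subr_eq opprK; apply/eqP.
  rewrite -(derive_derive_field oU _ Uu CZ1 (sPhi 2)) -(Xx1 _ Uu).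
  rewrite -derive_comp; [|exact: dPhi|exact: Cn_diff Cz1 (PhiY Uu)].
  by apply: (derive_eq_on _ oU) => // w; rewrite inE => /Zz1.
rewrite /bracket derive_dirB; last exact: dPhi.
rewrite (half _ _ _ _ CZ Cz Xx Zz) (half _ _ _ _ CX Cx Zz Xx).
rewrite (derive_comm (Z u) (X u) oU Uu (sPhi 2)).
by rewrite opprB addrA subrK.
Qed.

Variables (w : 'I_p -> 'rV[R]_p -> 'rV[R]_p) (cc : 'I_p -> 'I_p -> 'I_p -> 'rV[R]_p -> R^o).
Hypotheses (sw : forall n k, Cn n Y (w k)) (scc : forall n a b k, Cn n Y (cc a b k)).
Hypothesis ccE : forall a b y, Y y -> bracket (w a) (w b) y = \sum_k cc a b k y *: w k y.
Variable F : 'I_p -> 'rV[R]_m -> 'rV[R]_m.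
Hypothesis sF : forall n k, Cn n U (F k).
Hypothesis Fw : forall k u, U u -> 'D_(F k u) Phi u = w k (Phi u).
Hypothesis Fo : forall a b u, U u -> inner (G u) (F a u) (F b u) = (a == b)%:R.
Hypothesis Fh : forall k u v, U u -> 'D_v Phi u = 0 -> inner (G u) (F k u) v = 0.
Hypothesis Fdec : forall u v, U u -> 'D_(v - \sum_k inner (G u) v (F k u) *: F k u) Phi u = 0.

(* The vertical part of [F a, F b], whose horizontal part lifts [w a, w b]. *)
Definition vbracket a b u : 'rV[R]_m := bracket (F a) (F b) u - \sum_k cc a b k (Phi u) *: F k u.

(** Koszul's formula in an orthonormal frame, whose three derivative terms vanish. *)
Definition connection_coef a b k (y : 'rV[R]_p) : R^o :=
  2^-1 * (cc a b k y - cc a k b y - cc b k a y).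

Lemma inner_comb_frame u (f : 'I_p -> R) k : U u ->
  inner (G u) (\sum_l f l *: F l u) (F k u) = f k.
Proof.
move=> Uu; rewrite inner_suml (bigD1 k) //= innerZl Fo// eqxx mulr1 big1 ?addr0//.
by move=> l lk; rewrite innerZl Fo// (negbTE lk) mulr0.
Qed.

Lemma vbracket_vertical a b u : U u -> 'D_(vbracket a b u) Phi u = 0.
Proof.
move=> Uu; rewrite derive_dirB; last exact: dPhi.
rewrite (bracket_related Uu (sF 1 a) (sF 1 b) (sw 0 a) (sw 0 b) (@Fw a) (@Fw b)).
rewrite derive_linear_dir; last exact: dPhi.
rewrite ccE; last exact: PhiY.
apply/eqP; rewrite subr_eq0; apply/eqP; apply: eq_bigr => k _.
by rewrite -(Fw k Uu).
Qed.

Lemma Fhr k u v : U u -> 'D_v Phi u = 0 -> inner (G u) v (F k u) = 0.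
Proof. by move=> Uu v0; rewrite (innerC _ _ (GT Uu)) Fh. Qed.

Lemma inner_bracket_frame a b k u : U u ->
  inner (G u) (bracket (F a) (F b) u) (F k u) = cc a b k (Phi u).
Proof.
move=> Uu; have /eqP := Fhr k Uu (vbracket_vertical a b Uu).
by rewrite innerBl inner_comb_frame// subr_eq0 => /eqP.
Qed.

Let derive_frame v a b u : U u -> 'D_v (fun u => inner (G u) (F a u) (F b u) : R^o) u = 0.
Proof.
move=> Uu; have d0 : 'D_v (fun=> (a == b)%:R : R^o) u = 0 by exact: derive_cst.
rewrite -[RHS]d0; apply: (derive_eq_on _ oU) => // x; rewrite inE => Ux.
exact: Fo.
Qed.

Let koszul_val X Z T u dX dZ dT bXZ bXT bZT : U u -> Cn 1 U X -> Cn 1 U Z -> Cn 1 U T ->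
  'D_(X u) (fun x => inner (G x) (Z x) (T x) : R^o) u = dX ->
  'D_(Z u) (fun x => inner (G x) (T x) (X x) : R^o) u = dZ ->
  'D_(T u) (fun x => inner (G x) (X x) (Z x) : R^o) u = dT ->
  inner (G u) (bracket X Z u) (T u) = bXZ ->
  inner (G u) (bracket X T u) (Z u) = bXT ->
  inner (G u) (bracket Z T u) (X u) = bZT ->
  inner (G u) (covD G X Z u) (T u) = 2^-1 * (dX + dZ - dT + bXZ - bXT - bZT).
Proof.
move=> Uu CX CZ CT <- <- <- <- <- <-.
rewrite -(koszul oU sG GT Gu Uu CX CZ CT) mulrA mulVf ?mul1r//.
Qed.

Lemma inner_covD_frame a b k u : U u ->
  inner (G u) (covD G (F a) (F b) u) (F k u) = connection_coef a b k (Phi u).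
Proof.
move=> Uu.
rewrite (koszul_val Uu (sF 1 a) (sF 1 b) (sF 1 k)
  (derive_frame _ b k Uu) (derive_frame _ k a Uu) (derive_frame _ a b Uu)
  (inner_bracket_frame a b k Uu) (inner_bracket_frame a k b Uu)
  (inner_bracket_frame b k a Uu)).
by rewrite addr0 subr0 add0r.
Qed.

(** A vertical field is related to the zero field, whose bracket with any field vanishes. *)
Lemma bracket_vertical a (Z : 'rV[R]_m -> 'rV[R]_m) u : U u -> Cn 1 U Z ->
  (forall x, U x -> 'D_(Z x) Phi x = 0) -> 'D_(bracket (F a) Z u) Phi u = 0.
Proof.
move=> Uu CZ vZ.
rewrite (bracket_related (x := w a) (z := fun=> 0) Uu (sF 1 a) CZ (sw 0 a) (Cn_cst _ _ _) (@Fw a) vZ).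
rewrite /bracket derive0 subr0; exact: derive_cst.
Qed.

(** In Koszul's formula the derivatives vanish, as the inner products involved are constant, and the
    brackets with [Z] are vertical, hence orthogonal to the frame. Only the bracket of the two frame
    fields survives. *)
Lemma inner_covD_vertical a b (Z : 'rV[R]_m -> 'rV[R]_m) u : U u -> Cn 1 U Z ->
  (forall x, U x -> 'D_(Z x) Phi x = 0) ->
  inner (G u) (covD G (F a) (F b) u) (Z u) = 2^-1 * inner (G u) (vbracket a b u) (Z u).
Proof.
move=> Uu CZ vZ.
have dFZ k v : 'D_v (fun u => inner (G u) (F k u) (Z u) : R^o) u = 0.
  have d0 : 'D_v (fun=> 0 : R^o) u = 0 by exact: derive_cst.
  rewrite -[RHS]d0; apply: (derive_eq_on _ oU) => // x; rewrite inE => Ux.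
  by rewrite Fh// vZ.
have dZF k v : 'D_v (fun u => inner (G u) (Z u) (F k u) : R^o) u = 0.
  have d0 : 'D_v (fun=> 0 : R^o) u = 0 by exact: derive_cst.
  rewrite -[RHS]d0; apply: (derive_eq_on _ oU) => // x; rewrite inE => Ux.
  by rewrite Fhr// vZ.
have bZ c := Fhr c Uu (bracket_vertical _ Uu CZ vZ).
rewrite (koszul_val Uu (sF 1 a) (sF 1 b) CZ (dFZ b _) (dZF a _) (derive_frame _ a b Uu)
  erefl (bZ _ _) (bZ _ _)).
rewrite !(addr0, subr0, add0r) /vbracket [in RHS]innerBl inner_suml big1 ?subr0//.
by move=> k _; rewrite innerZl Fh ?vZ ?mulr0.
Qed.

(* Every vertical vector extends to a vertical field: project a constant field. *)
Lemma vertical_extension u v : U u -> 'D_v Phi u = 0 ->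
  exists Z, [/\ Cn 1 U Z, forall x, U x -> 'D_(Z x) Phi x = 0 & Z u = v].
Proof.
move=> Uu v0; exists (fun x => v - \sum_k inner (G x) v (F k x) *: F k x); split.
- apply: CnB => //; first exact: Cn_cst.
  apply: Cn_sum => // k _; apply: Cn_scale => //.
  have : Cn 1 U (fun x => v *m G x *m (F k x)^T).
    by apply: Cn_mulmx => //; [apply: Cn_mulmx => //; exact: Cn_cst|exact: Cn_trmx].
  by move/(Cn_mx _ _ oU)/(_ 0 0).
- by move=> x Ux; exact: Fdec.
by rewrite big1 ?subr0// => k _; rewrite Fhr// scale0r.
Qed.

(** The difference [z] of the two sides is orthogonal to the frame, hence vertical. Extended to a
    vertical field, as Koszul's formula requires, it is orthogonal to itself. *)
Lemma covD_frame a b u : U u ->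
  covD G (F a) (F b) u =
  \sum_k connection_coef a b k (Phi u) *: F k u + 2^-1 *: vbracket a b u.
Proof.
move=> Uu.
set H := \sum_k _; set A := vbracket a b u.
have vA : 'D_A Phi u = 0 by exact: vbracket_vertical.
set z := covD G (F a) (F b) u - (H + 2^-1 *: A).
have zF k : inner (G u) z (F k u) = 0.
  rewrite innerBl (innerDl _ H) innerZl (inner_covD_frame a b k Uu) (inner_comb_frame _ k Uu).
  by rewrite (Fhr _ Uu vA) mulr0 addr0 subrr.
have vz : 'D_z Phi u = 0.
  have := Fdec z Uu; rewrite big1 ?subr0// => k _.
  by rewrite zF scale0r.
have [Z [CZ vZ Zu]] := vertical_extension Uu vz.
have zz : inner (G u) z z = 0.
  rewrite -[X in inner _ _ X]Zu {1}/z innerBl (innerDl _ H) innerZl.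
  rewrite (inner_covD_vertical a b Uu CZ vZ) /H inner_suml big1 ?add0r ?subrr//.
  by move=> k _; rewrite innerZl Fh ?vZ ?mulr0.
apply/eqP; rewrite -subr_eq0 -/z; apply/negPn/negP => /(Gpos Uu).
by rewrite zz ltxx.
Qed.

(* The sectional curvature of the base in terms of the structure functions of the
   orthonormal frame [w] alone. *)
Definition base_curvature i j (y : 'rV[R]_p) : R :=
  'D_(w i y) (connection_coef j j i) y
  - \sum_k connection_coef j j k y * connection_coef i i k y
  - 'D_(w j y) (connection_coef i j i) y
  + \sum_k connection_coef i j k y * connection_coef j i k y
  - \sum_k cc i j k y * connection_coef k j i y.

Lemma Cn_vbracket n a b : Cn n U (vbracket a b).
Proof.
have Cf k : Cn n U (fun u => cc a b k (Phi u) : R^o).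
  exact: (Cn_comp oU PhiY (sPhi n) (scc n a b k)).
apply: CnB => //.
  by apply: CnB => //; apply: Cn_derive_field => //.
by apply: Cn_sum => // k _; exact: Cn_scale.
Qed.

(** The differentiated function is lifted from the base, so its derivative along [F l] is a
    derivative along [w l] downstairs and does not see the metric upstairs. *)
Lemma derive_covD_frame a b k l u : U u ->
  'D_(F l u) (fun x => inner (G x) (covD G (F a) (F b) x) (F k x) : R^o) u =
  'D_(w l (Phi u)) (connection_coef a b k) (Phi u).
Proof.
move=> Uu; rewrite -(Fw l Uu) -derive_comp; [|exact: dPhi|].
  apply: (derive_eq_on _ oU) => // x; rewrite inE => Ux.
  exact: inner_covD_frame.
have dc a' b' k' : differentiable (cc a' b' k') (Phi u).
  exact: Cn_diff (scc 0 a' b' k') (PhiY Uu).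
apply: differentiableM; first exact: differentiable_cst.
by apply: differentiableB => //; exact: differentiableB.
Qed.

Lemma inner_covD_covD a b a' b' u : U u ->
  inner (G u) (covD G (F a) (F b) u) (covD G (F a') (F b') u) =
  \sum_k connection_coef a b k (Phi u) * connection_coef a' b' k (Phi u)
  + 4^-1 * inner (G u) (vbracket a b u) (vbracket a' b' u).
Proof.
move=> Uu.
rewrite [X in inner _ X _](covD_frame a b Uu) innerDl innerZl inner_suml; congr (_ + _).
  apply: eq_bigr => k _; rewrite innerZl (innerC _ _ (GT Uu)).
  by rewrite inner_covD_frame.
rewrite (covD_frame a' b' Uu) innerDr innerZr inner_sumr big1 ?add0r.
  by rewrite mulrA; congr (_ * _); lra.
by move=> k _; rewrite innerZr (Fhr _ Uu (vbracket_vertical _ _ Uu)) mulr0.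
Qed.

Lemma inner_vbracket_covD a b a' b' u : U u ->
  inner (G u) (vbracket a b u) (covD G (F a') (F b') u) =
  2^-1 * inner (G u) (vbracket a b u) (vbracket a' b' u).
Proof.
move=> Uu; rewrite covD_frame// innerDr innerZr inner_sumr big1 ?add0r//.
by move=> k _; rewrite innerZr (Fhr _ Uu (vbracket_vertical _ _ Uu)) mulr0.
Qed.

Lemma vbracketC i j u : U u -> vbracket j i u = - vbracket i j u.
Proof.
move=> Uu.
have ccC k : cc j i k (Phi u) = - cc i j k (Phi u).
  rewrite -!inner_bracket_frame// -innerNl; congr (inner _ _ _).
  by rewrite /bracket opprB.
rewrite /vbracket opprB (eq_bigr (fun k => - (cc i j k (Phi u) *: F k u))).
  by rewrite sumrN opprK addrC; congr (_ + _); rewrite /bracket opprB.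
by move=> k _; rewrite ccC scaleNr.
Qed.

Lemma covD_dirD X X' Z u : differentiable Z u ->
  covD G (fun x => X x + X' x) Z u = covD G X Z u + covD G X' Z u.
Proof.
by move=> dZ; rewrite !covDE derive_dirD// bilinDl addrACA.
Qed.

Lemma covD_congr X X' Z u : X u = X' u -> covD G X Z u = covD G X' Z u.
Proof. by rewrite /covD => ->. Qed.

(** The direction of a covariant derivative enters linearly and pointwise, so the bracket splits
    into its horizontal part, which gives the sum, and its vertical part A, which gives half of
    |A|^2. *)
Lemma inner_covD_bracket i j u : U u ->
  inner (G u) (covD G (bracket (F i) (F j)) (F j) u) (F i u) =
  \sum_k cc i j k (Phi u) * connection_coef k j i (Phi u)
  + 2^-1 * inner (G u) (vbracket i j u) (vbracket i j u).
Proof.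
move=> Uu; have dF := Cn_diff (sF 0 j) Uu.
have -> : covD G (bracket (F i) (F j)) (F j) u =
    covD G (fun x => \sum_k cc i j k (Phi x) *: F k x + vbracket i j x) (F j) u.
  by apply: covD_congr; rewrite /vbracket addrC subrK.
rewrite covD_dirD// innerDl; congr (_ + _).
  rewrite covDE derive_linear_dir// innerDl inner_suml.
  have -> : bilin (christoffel_mx G u) (\sum_k cc i j k (Phi u) *: F k u) (F j u) =
     \sum_k cc i j k (Phi u) *: bilin (christoffel_mx G u) (F k u) (F j u).
    apply/rowP => l; rewrite mxE inner_suml summxE; apply: eq_bigr => k _.
    by rewrite innerZl !mxE.
  rewrite inner_suml -big_split; apply: eq_bigr => k _ /=.
  by rewrite !innerZl -mulrDr -innerDl -covDE inner_covD_frame.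
have CA n := Cn_vbracket n i j.
have vA x : U x -> 'D_(vbracket i j x) Phi x = 0 by exact: vbracket_vertical.
(* Zero torsion exchanges A and F_j; the bracket of the two is vertical and drops out against
   F_i. *)
have -> : covD G (vbracket i j) (F j) u =
    covD G (F j) (vbracket i j) u - bracket (F j) (vbracket i j) u.
  by rewrite -(covD_torsion oU sG GT _ _ Uu) opprB addrC subrK.
rewrite innerBl (Fhr _ Uu (bracket_vertical _ Uu (CA 1) vA)) subr0.
(* Since A is orthogonal to F_i, the derivative moves from A to F_i with a sign; the vertical part
   of nabla_{F_j} F_i is -A / 2, which restores the plus sign. *)
have := covD_metric oU sG GT Gu (F j) Uu (CA 1%N) (sF 1 i).
have -> : 'D_(F j u) (fun x => inner (G x) (vbracket i j x) (F i x) : R^o) u = 0.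
  have d0 : 'D_(F j u) (fun=> 0 : R^o) u = 0 by exact: derive_cst.
  rewrite -[RHS]d0; apply: (derive_eq_on _ oU) => // x; rewrite inE => Ux.
  by rewrite Fhr// vA.
rewrite inner_vbracket_covD// (vbracketC i j Uu) innerNr mulrN => /esym/eqP.
by rewrite subr_eq0 => /eqP.
Qed.

(** Metric compatibility turns each iterated covariant derivative into a derivative from the base
    minus an inner product of first ones. The coefficient -3/4 is -1/4 from nabla_{F_i} F_j against
    nabla_{F_j} F_i, plus -1/2 from the bracket term. *)
Lemma oneill i j u : U u ->
  inner (G u) (curv G (F i) (F j) (F j) u) (F i u) =
  base_curvature i j (Phi u) - 3 / 4 * inner (G u) (vbracket i j u) (vbracket i j u).
Proof.
move=> Uu; have CC a b : Cn 1 U (covD G (F a) (F b)) by exact: Cn_covD.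
have step a b k l : inner (G u) (covD G (F l) (covD G (F a) (F b)) u) (F k u) =
    'D_(w l (Phi u)) (connection_coef a b k) (Phi u)
    - inner (G u) (covD G (F a) (F b) u) (covD G (F l) (F k) u).
  rewrite -(derive_covD_frame a b k l Uu).
  rewrite (covD_metric oU sG GT Gu _ Uu (CC a b) (sF 1 k)).
  by rewrite addrK.
have vjj : vbracket j j u = 0.
  have /eqP := vbracketC j j Uu; rewrite -subr_eq0 opprK -mulr2n -scaler_nat.
  by rewrite scaler_eq0 pnatr_eq0 /= => /eqP.
have v1 : inner (G u) (vbracket j j u) (vbracket i i u) = 0 by rewrite vjj inner0l.
have v2 : inner (G u) (vbracket i j u) (vbracket j i u) =
    - inner (G u) (vbracket i j u) (vbracket i j u).
  by rewrite (vbracketC i j Uu) innerNr.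
have sum_up (d1 d2 q1 q2 s1 s2 s3 b1 b2 b x1 x2 x3 : R) :
    x1 = d1 - q1 -> x2 = d2 - q2 -> x3 = s3 + 2^-1 * b ->
    q1 = s1 + 4^-1 * b1 -> q2 = s2 + 4^-1 * b2 -> b1 = 0 -> b2 = - b ->
    x1 - x2 - x3 = d1 - s1 - d2 + s2 - s3 - 3 / 4 * b.
  by move=> -> -> -> -> -> -> ->; lra.
have innerB3 (H : 'M[R]_m) (x y z v : 'rV[R]_m) :
    inner H (x - y - z) v = inner H x v - inner H y v - inner H z v.
  by rewrite !innerBl.
apply: etrans (innerB3 _ _ _ _ _) _.
exact: sum_up (step j j i i) (step i j i j) (inner_covD_bracket i j Uu)
  (inner_covD_covD j j i i Uu) (inner_covD_covD i j j i Uu) v1 v2.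
Qed.

End ONeill.

(** * Dependence on time *)

Lemma openX (T T' : topologicalType) (A : set T) (B : set T') :
  open A -> open B -> open (A `*` B).
Proof.
move=> oA oB; rewrite openE => -[a b] [/= Aa Bb].
by exists (A, B) => //; split; exact: open_nbhs_nbhs.
Qed.

Section Time.
Context {R : realType} {m : nat}.
Local Notation TV := (R^o * 'rV[R]_m)%type.
Implicit Types (X Z : TV -> 'rV[R]_m) (u : 'rV[R]_m) (t : R).

Definition dt : TV := (1, 0).

Lemma is_diff_slice t u : is_diff u (fun u => (t, u) : TV) (fun v => (0, v) : TV).
Proof. exact: (is_diff_pair (is_diff_cst (t : R^o) u) (is_diff_id u)). Qed.

Lemma is_diff_time t u : is_diff (t : R^o) (fun t : R^o => (t, u) : TV) (fun s : R^o => (s, 0) : TV).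
Proof. exact: (is_diff_pair (is_diff_id (t : R^o)) (is_diff_cst u (t : R^o))). Qed.

Lemma is_diff_snd (z : TV) : is_diff z (@snd R^o 'rV[R]_m) (@snd R^o 'rV[R]_m).
Proof.
have cs : continuous (@snd R^o 'rV[R]_m) by move=> y; exact: cvg_snd.
by apply: DiffDef; [exact: linear_differentiable|rewrite diff_lin].
Qed.

Lemma derive_slice (W : normedModType R) (f : TV -> W) t u v : differentiable f (t, u) ->
  'D_v (fun u => f (t, u)) u = 'D_((0, v) : TV) f (t, u).
Proof.
move=> df; have ds := is_diff_slice t u.
have -> : (fun u => f (t, u)) = f \o (fun u => (t, u) : TV) by [].
rewrite deriveE; last by apply: differentiable_comp.
by rewrite diff_comp// /= diff_val deriveE.
Qed.

Lemma is_derive_time (W : normedModType R) (f : TV -> W) t u : differentiable f (t, u) ->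
  is_derive (t : R^o) 1 (fun t : R^o => f (t, u)) ('D_dt f (t, u)).
Proof.
move=> df; have ds := is_diff_time t u.
have dc : differentiable (f \o (fun t : R^o => (t, u) : TV)) (t : R^o).
  by apply: differentiable_comp.
apply: DeriveDef; first exact: diff_derivable.
rewrite deriveE// diff_comp// /= diff_val deriveE//.
Qed.

Lemma Cn_slice n (W : normedModType R) (I : set R^o) (U : set 'rV[R]_m) (f : TV -> W) t :
  open U -> I t -> Cn n (I `*` U) f -> Cn n U (fun u => f (t, u)).
Proof.
move=> oU It; apply: (@Cn_comp_affine _ _ _ _ n U _ f _ (fun v => (0, v))) => //.
- by move=> u; have ds := is_diff_slice t u; exact: ex_diff.
- move=> u v; have ds := is_diff_slice t u.
  by rewrite deriveE// diff_val.
Qed.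

Lemma Cn_static n (W : normedModType R) (I : set R^o) (U : set 'rV[R]_m) (f : 'rV[R]_m -> W) :
  open I -> open U -> Cn n U f -> Cn n (I `*` U) (fun z : TV => f z.2).
Proof.
move=> oI oU; apply: (@Cn_comp_affine _ _ _ _ n (I `*` U) U f _ snd) => //.
- exact: openX.
- by move=> z; have ds := is_diff_snd z; exact: ex_diff.
- move=> z v; have ds := is_diff_snd z.
  by rewrite deriveE// diff_val.
- by move=> z [].
Qed.

Let e_ (k : 'I_m) : TV := (0, delta_mx 0 k).

Lemma slice_dir_sum (v : 'rV[R]_m) : ((0, v) : TV) = \sum_k v 0 k *: e_ k.
Proof.
rewrite [in LHS](row_sum_delta v).
apply: (big_ind2 (fun (a : 'rV[R]_m) (b : TV) => (0, a) = b)) => [//|a _ b _ <- <-|k _].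
- exact: (congr1 (fun x : R^o => (x, a + b)) (esym (addr0 (0 : R^o)))).
- exact: (congr1 (fun x : R^o => (x, v 0 k *: delta_mx 0 k)) (esym (scaler0 R^o (v 0 k) : v 0 k *: (0 : R^o) = 0))).
Qed.

Variables (I : set R^o) (U : set 'rV[R]_m).
Hypotheses (oI : open I) (oU : open U).
Let O : set TV := I `*` U.
Let oO : open O. Proof. exact: openX. Qed.

(** Both the direction and the differentiated field move, whence two terms; the second one has its
    time derivative inside by Schwarz on space-time. *)
Lemma is_derive_time_field X Z t u : I t -> U u -> Cn 1 O X -> Cn 2 O Z ->
  is_derive (t : R^o) 1 (fun s : R^o => 'D_(X (s, u)) (fun w => Z (s, w)) u)
   ('D_('D_dt X (t, u)) (fun w => Z (t, w)) u
    + 'D_(X (t, u)) (fun w => 'D_dt Z (t, w)) u).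
Proof.
move=> It Uu CX CZ; have Otu : O (t, u) by [].
(* The spatial derivative is rewritten as a derivative on space-time along directions with zero time
   component, so that the product rule along [dt] applies. *)
pose Q (z : TV) := 'D_(\sum_k X z 0 k *: e_ k) Z z.
have CQ : Cn 1 O Q by exact: Cn_derive_along.
have QE s : I s -> 'D_(X (s, u)) (fun w => Z (s, w)) u = Q (s, u).
  move=> Is; rewrite derive_slice; last exact: (Cn_diff CZ (_ : O (s, u))).
  by rewrite slice_dir_sum.
have := is_derive_time (Cn_diff CQ Otu).
rewrite /Q (derive_derive_along _ _ oO Otu CX CZ) -!slice_dir_sum.
rewrite (derive_comm dt _ oO Otu CZ).
rewrite -derive_slice; last exact: Cn_diff CZ Otu.
rewrite -derive_slice; last exact: Cn_diff (Cn_derive dt CZ) Otu.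
apply: near_eq_is_derive; apply: filterS (open_nbhs_nbhs (conj oI It)) => s Is.
by rewrite QE.
Qed.

Lemma is_derive_time_bracket X Z t u : I t -> U u -> Cn 2 O X -> Cn 2 O Z ->
  is_derive (t : R^o) 1 (fun s : R^o => bracket (fun w => X (s, w)) (fun w => Z (s, w)) u)
   (bracket (fun w => 'D_dt X (t, w)) (fun w => Z (t, w)) u
    + bracket (fun w => X (t, w)) (fun w => 'D_dt Z (t, w)) u).
Proof.
move=> It Uu CX CZ.
have dXZ := is_derive_time_field It Uu (Cn_pred CX) CZ.
have dZX := is_derive_time_field It Uu (Cn_pred CZ) CX.
apply: (is_derive_eq (is_deriveB dXZ dZX)).
by rewrite /bracket opprD [X in _ + X = _]addrC addrACA.
Qed.

End Time.

Lemma bracket_eq_on {R : realType} {m : nat} (U : set 'rV[R]_m)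
    (X X' Z Z' : 'rV[R]_m -> 'rV[R]_m) u : open U -> U u ->
  {in U, X =1 X'} -> {in U, Z =1 Z'} -> bracket X Z u = bracket X' Z' u.
Proof.
move=> oU Uu XX ZZ; rewrite /bracket (XX _ (mem_set Uu)) (ZZ _ (mem_set Uu)).
by congr (_ - _); exact: derive_eq_on Uu.
Qed.

Lemma bracketNl {R : realType} {m : nat} (X Z : 'rV[R]_m -> 'rV[R]_m) u :
  differentiable X u -> differentiable Z u ->
  bracket (fun w => - X w) Z u = - bracket X Z u.
Proof.
move=> dX dZ; rewrite /bracket -scaleN1r (derive_dirZ _ _ dZ) scaleN1r.
rewrite [X in _ - X](_ : _ = - 'D_(Z u) X u).
  by rewrite opprD.
by apply: deriveN; exact: diff_derivable.
Qed.

Lemma bracketNr {R : realType} {m : nat} (X Z : 'rV[R]_m -> 'rV[R]_m) u :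
  differentiable X u -> differentiable Z u ->
  bracket X (fun w => - Z w) u = - bracket X Z u.
Proof.
move=> dX dZ.
have anti (A B : 'rV[R]_m -> 'rV[R]_m) : bracket A B u = - bracket B A u by rewrite /bracket opprB.
by rewrite anti (bracketNl dZ dX); congr (- _); exact: esym (anti X Z).
Qed.

(** * First and second variation of a squared norm *)

Section Variation.
Context {R : realType} {m p : nat}.

Lemma is_derive_inner_time (H : 'M[R]_m) (X Y : R^o -> 'rV[R]_m) (t : R^o) (X' Y' : 'rV[R]_m) :
  is_derive t 1 X X' -> is_derive t 1 Y Y' ->
  is_derive t 1 (fun s => inner H (X s) (Y s) : R^o) (inner H X' (Y t) + inner H (X t) Y').
Proof.
move=> dX dY.
have fX : differentiable X t by apply/derivable1_diffP; exact: ex_derive.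
have fY : differentiable Y t by apply/derivable1_diffP; exact: ex_derive.
have fH : differentiable (fun _ : R^o => H) t by exact: differentiable_cst.
apply: DeriveDef; first by apply: diff_derivable; exact: (differentiable_inner fH fX fY).
rewrite (derive_inner _ fH fX fY) !derive_val.
by rewrite innerM0 add0r.
Qed.

(** The calculus of the final formulas, at a fixed point: [H] is the metric at time [t], used at all
    times, [A] the vertical bracket, [S] the sum of mixed brackets, [B] the bracket of V_i and V_j.
    Then A' = N gives f' = -3/2 H(N, A), and a second differentiation adds -3/2 H(N, N). *)
Lemma squared_norm_variation (H : 'M[R]_m) (c : 'I_p -> R) (K : R) (I : set R^o)
    (f : R^o -> R^o) (A S : R^o -> 'rV[R]_m) (V : 'I_p -> R^o -> 'rV[R]_m)
    (dV : 'I_p -> 'rV[R]_m) (dS B : 'rV[R]_m) (t : R^o) :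
  H^T = H -> open I -> I t ->
  (forall s, I s -> f s = K - 3 / 4 * inner H (A s) (A s)) ->
  (forall s, I s -> is_derive s 1 A (\sum_k c k *: V k s - S s)) ->
  (forall k, is_derive t 1 (V k) (dV k)) ->
  is_derive t 1 S (dS - 2 *: B) ->
  is_derive t 1 f (- (3 / 2) * \sum_k c k * inner H (V k t) (A t) + 3 / 2 * inner H (S t) (A t))
  /\
  is_derive t 1 (derive1 f)
    (- (3 / 2) * \sum_k c k * inner H (dV k) (A t)
     - 3 / 2 * \sum_k \sum_l c k * c l * inner H (V k t) (V l t)
     + 3 * \sum_k c k * inner H (V k t) (S t)
     + 3 / 2 * inner H dS (A t)
     - 3 * inner H B (A t)
     - 3 / 2 * inner H (S t) (S t)).
Proof.
move=> HT oI It fE dA dVt dSt.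
pose N s := \sum_k c k *: V k s - S s.
have df s : I s -> is_derive s 1 f (- (3 / 2) * inner H (N s) (A s)).
  move=> Is; have dAA := is_derive_inner_time H (dA s Is) (dA s Is).
  have dKA : is_derive s 1 (fun s => K - 3 / 4 * inner H (A s) (A s) : R^o)
      (- (3 / 2) * inner H (N s) (A s)).
    have dKA := is_deriveB (is_derive_cst (K : R^o) s 1) (is_deriveZ (3 / 4) dAA).
    apply: is_derive_eq dKA _.
    rewrite (innerC (A s) _ HT) -/(N s) /GRing.scale /=; lra.
  apply: near_eq_is_derive dKA; apply: filterS (open_nbhs_nbhs (conj oI Is)) => r Ir.
  by rewrite fE.
split.
  apply: is_derive_eq (df t It) _.
  rewrite innerBl inner_suml; under [in RHS]eq_bigr do rewrite -innerZl; lra.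
have dN : is_derive t 1 N (\sum_k c k *: dV k - (dS - 2 *: B)).
  have dsum : is_derive t 1 (\sum_k (fun s => c k *: V k s)) (\sum_k c k *: dV k).
    by apply: is_derive_sum => k; exact: is_deriveZ.
  rewrite (_ : N = \sum_k (fun s => c k *: V k s) - S); first exact: is_deriveB.
  by apply/funext => s; rewrite !fctE fct_sumE.
have dNA : is_derive t 1 (fun s => - (3 / 2) * inner H (N s) (A s) : R^o)
    (- (3 / 2) * (inner H (\sum_k c k *: dV k - (dS - 2 *: B)) (A t) + inner H (N t) (N t))).
  exact: (is_deriveZ (- (3 / 2)) (is_derive_inner_time H dN (dA t It))).
(* The formula for f' is known on [I] only; openness makes it valid near [t], enough to
   differentiate it. *)
have dE : is_derive t 1 (derive1 f)
    (- (3 / 2) * (inner H (\sum_k c k *: dV k - (dS - 2 *: B)) (A t) + inner H (N t) (N t))).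
  apply: near_eq_is_derive dNA; apply: filterS (open_nbhs_nbhs (conj oI It)) => r Ir.
  have dfr := df r Ir; by rewrite derive1E derive_val.
apply: is_derive_eq dE _.
rewrite /N !innerBl !innerBr innerZl !inner_suml.
rewrite (inner_sumr _ (S t)).
have E1 k : inner H (c k *: dV k) (A t) = c k * inner H (dV k) (A t) by exact: innerZl.
rewrite (eq_bigr _ (fun k _ => E1 k)).
have E2 k : inner H (c k *: V k t) (S t) = c k * inner H (V k t) (S t) by exact: innerZl.
rewrite (eq_bigr _ (fun k _ => E2 k)).
have E3 k : inner H (S t) (c k *: V k t) = c k * inner H (V k t) (S t).
  by rewrite innerZr innerC.
rewrite (eq_bigr _ (fun k _ => E3 k)).
have E4 k : inner H (c k *: V k t) (\sum_l c l *: V l t) =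
    \sum_l c k * c l * inner H (V k t) (V l t).
  by rewrite innerZl inner_sumr mulr_sumr; apply: eq_bigr => l _; rewrite innerZr mulrA.
rewrite (eq_bigr _ (fun k _ => E4 k)).
move: (\sum_k _) (\sum_k _) (\sum_k _) => x y z.
move: (inner H dS _) (inner H B _) (inner H (S t) _) => ? ? ?; lra.
Qed.

End Variation.

(** * Charts *)

Section LinearLift.
Context {R : realType} {m p : nat}.

Lemma posdef_eq0 (G : 'M[R]_m) (z : 'rV[R]_m) :
  (forall v, v != 0 -> 0 < inner G v v) -> inner G z z = 0 -> z = 0.
Proof.
move=> Gpos zz; apply/eqP/negPn/negP => /Gpos.
by rewrite zz ltxx.
Qed.

(* The right inverse of [D] with G-horizontal image, in a form that depends
   smoothly on [D] and [G]. *)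
Definition lift_mx (D : 'M[R]_(m, p)) (G : 'M[R]_m) : 'M[R]_(p, m) :=
  invmx (D^T *m invmx G *m D) *m D^T *m invmx G.

Variables (D : 'M[R]_(m, p)) (G : 'M[R]_m).
Hypotheses (Gpos : forall v, v != 0 -> 0 < inner G v v) (GT : G^T = G).
Hypothesis Dsurj : forall w : 'rV[R]_p, exists v, v *m D = w.

(** If w kills the matrix, z = w D^T G^-1 has G-norm zero, so w D^T = 0. Writing w = v D by
    surjectivity then gives w w^T = 0, a vanishing sum of squares. *)
Lemma lift_gram_unitmx : D^T *m invmx G *m D \in unitmx.
Proof.
have Gu := posdef_unitmx Gpos.
rewrite -row_free_unit -kermx_eq0; apply/rowV0P => w /sub_kermxP wS.
have z0 : w *m D^T *m invmx G = 0.
  apply: (posdef_eq0 Gpos).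
  have := wS; rewrite !mulmxA => E.
  by rewrite /inner mulmxKV// !trmx_mul trmxK trmx_inv GT !mulmxA E mul0mx mxE.
have wD : w *m D^T = 0 by rewrite -(mulmxKV Gu (w *m D^T)) z0 mul0mx.
have [v vD] := Dsurj w.
have ww : w *m w^T = 0 by rewrite -{2}vD trmx_mul mulmxA wD mul0mx.
apply/rowP => k; rewrite mxE; apply/eqP; rewrite -sqrf_eq0.
have /eqP : \sum_k w 0 k ^+ 2 = 0.
  have := congr1 (fun Z : 'M[R]_1 => Z 0 0) ww; rewrite !mxE => E.
  by rewrite -[RHS]E; apply: eq_bigr => l _; rewrite mxE expr2.
rewrite psumr_eq0; last by move=> l _; exact: sqr_ge0.
by move/allP => /(_ k); rewrite mem_index_enum => /(_ isT).
Qed.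

Lemma lift_mxK : lift_mx D G *m D = 1%:M.
Proof. by rewrite /lift_mx -!mulmxA mulVmx// !mulmxA lift_gram_unitmx. Qed.

Lemma lift_mx_horizontal (w : 'rV[R]_p) v : v *m D = 0 -> inner G (w *m lift_mx D G) v = 0.
Proof.
move=> vD; have Gu := posdef_unitmx Gpos.
rewrite /inner /lift_mx !mulmxA mulmxKV// -!mulmxA -trmx_mul vD trmx0.
by rewrite !mulmx0 mxE.
Qed.

End LinearLift.

(** For the matrix M of rows W k, orthonormality says that H M^T is a right inverse. As M is square,
    it is a left inverse too, and this is the expansion. *)
Lemma orthonormal_expansion {R : realType} {p : nat} (H : 'M[R]_p) (W : 'I_p -> 'rV[R]_p) w :
  (forall i j, inner H (W i) (W j) = (i == j)%:R) -> w = \sum_k inner H w (W k) *: W k.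
Proof.
move=> HW; pose M : 'M[R]_p := \matrix_(k, l) W k 0 l.
have rM k : row k M = W k by apply/rowP => l; rewrite !mxE.
have MH : M *m (H *m M^T) = 1%:M.
  apply/matrixP => i j; rewrite mulmxA -[LHS]mulr1 [RHS]mxE -HW /inner -!rM tr_row.
  rewrite mulr1 -row_mul mxE [RHS]mxE; apply: eq_bigr => k _.
  by rewrite !mxE.
rewrite [LHS](_ : w = w *m (H *m M^T) *m M); last by rewrite -mulmxA (mulmx1C MH) mulmx1.
rewrite mulmx_sum_row; apply: eq_bigr => k _; rewrite rM; congr (_ *: _).
rewrite /inner -rM mulmxA mxE [RHS]mxE; apply: eq_bigr => l _.
by rewrite !mxE.
Qed.

(** * Chart changes, metrics and fields in coordinates *)

Section Charts.
Context {R : realType} {m : nat} {M : manifold R m}.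

Lemma open_chart_part (c : chart R m M) (A : set M) : open A ->
  open (fwd c @` (chart_dom c `&` A)).
Proof.
move=> oA; rewrite openE => _ [x [cx Ax] <-].
have cu : chart_image c (fwd c x) by exists x.
have nb : nbhs (fwd c x) (bwd c @^-1` A).
  apply: (bwd_cts cu); rewrite fwdK//.
  exact: open_nbhs_nbhs.
apply: filterS (filterI (open_nbhs_nbhs (conj (@chart_image_open _ _ _ c) cu)) nb).
move=> _ [[y cy <-]] /=; rewrite fwdK// => Ay.
by exists y.
Qed.

Section ChartChange.
Variables (c c' c'' : chart R m M) (x : M).
Hypotheses (ac : atlas c) (ac' : atlas c') (ac'' : atlas c'').
Hypotheses (xc : chart_dom c x) (xc' : chart_dom c' x) (xc'' : chart_dom c'' x).

Lemma transition_differentiable : differentiable (fwd c' \o bwd c) (fwd c x).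
Proof. by have := atlas_smooth ac ac'; move/(_ [::] (fwd c x)); apply; exists x. Qed.

Lemma chart_changeE v : chart_change c c' x v = 'D_v (fwd c' \o bwd c) (fwd c x).
Proof. by rewrite deriveE//; exact: transition_differentiable. Qed.

End ChartChange.

(** The chain rule; the composed transition maps agree with the direct one only on the overlap,
    which is open, so their derivatives agree. *)
Lemma chart_change_cocycle c c' c'' (x : M) v :
  atlas c -> atlas c' -> atlas c'' ->
  chart_dom c x -> chart_dom c' x -> chart_dom c'' x ->
  chart_change c' c'' x (chart_change c c' x v) = chart_change c c'' x v.
Proof.
move=> ac ac' ac'' xc xc' xc''.
rewrite (chart_changeE ac ac'' xc xc'') (chart_changeE ac ac' xc xc') (chart_changeE ac' ac'' xc' xc'').
have oU := @open_chart_part c _ (@chart_dom_open _ _ _ c').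
have Uu : (fwd c @` (chart_dom c `&` chart_dom c')) (fwd c x) by exists x.
have dcc' : differentiable (fwd c' \o bwd c) (fwd c x) by exact: transition_differentiable.
have E : (fwd c' \o bwd c) (fwd c x) = fwd c' x by rewrite /= fwdK.
have dcc'' : differentiable (fwd c'' \o bwd c') ((fwd c' \o bwd c) (fwd c x)).
  by rewrite E; exact: transition_differentiable.
rewrite -E -(derive_comp _ dcc' dcc'').
apply: (derive_eq_on _ oU) => // u; rewrite inE => -[y [yc yc'] <-] /=.
by rewrite !fwdK.
Qed.

Lemma chart_change_id c (x : M) v : atlas c -> chart_dom c x -> chart_change c c x v = v.
Proof.
move=> ac xc; rewrite chart_changeE// -[RHS](derive_id (fwd c x)).
have oU := @open_chart_part c _ (@chart_dom_open _ _ _ c).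
apply: (derive_eq_on _ oU); last by exists x.
by move=> u; rewrite inE => -[y [yc _] <-] /=; rewrite fwdK.
Qed.

Lemma chart_changeK c c' (x : M) : atlas c -> atlas c' -> chart_dom c x -> chart_dom c' x ->
  cancel (chart_change c c' x) (chart_change c' c x).
Proof. by move=> ? ? ? ? v; rewrite chart_change_cocycle// chart_change_id. Qed.

Lemma chart_changeZ c c' (x : M) a v :
  chart_change c c' x (a *: v) = a *: chart_change c c' x v.
Proof. by rewrite /chart_change linearZ. Qed.

Lemma chart_change_mx c c' (x : M) v :
  chart_change c c' x v = v *m lin1_mx (chart_change c c' x).
Proof. by rewrite /chart_change mul_rV_lin1. Qed.

Lemma inner_local_gram c (g : tensor2 M) u a b :
  let x := bwd c u in
  inner (local_gram c g u) a b =
  inner (g x) (chart_change c (chart_at x) x a) (chart_change c (chart_at x) x b).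
Proof.
move=> x; rewrite !chart_change_mx /inner /local_gram trmx_mul !mulmxA.
by [].
Qed.

Lemma inner_local_gram_at c (g : tensor2 M) (x : M) a b : atlas c -> chart_dom c x ->
  inner (local_gram c g (fwd c x)) (chart_change (chart_at x) c x a)
    (chart_change (chart_at x) c x b) = inner (g x) a b.
Proof.
move=> ac xc; rewrite inner_local_gram/= fwdK// !chart_changeK//; 
  by [exact: chart_at_atlas|exact: chart_at_in].
Qed.

Lemma local_field_at c (X : vfield M) (x : M) : chart_dom c x ->
  local_field c X (fwd c x) = chart_change (chart_at x) c x (X x).
Proof. by move=> xc; rewrite /local_field fwdK. Qed.

End Charts.
Arguments open_chart_part {R m M} c {A}.

(** * Differentials of maps in charts *)

Section DMap.
Context {R : realType} {m k : nat} {M : manifold R m} {N : manifold R k}.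
Variable f : M -> N.
Hypothesis smf : smooth_map f.

Definition chart_overlap (c : chart R m M) (d : chart R k N) : set 'rV[R]_m :=
  fwd c @` (chart_dom c `&` f @^-1` chart_dom d).

Definition local_map (c : chart R m M) (d : chart R k N) : 'rV[R]_m -> 'rV[R]_k :=
  fwd d \o f \o bwd c.

Lemma open_chart_overlap c d : open (chart_overlap c d).
Proof.
apply: open_chart_part; have [cf _] := smf.
by move/continuousP : cf; apply; exact: chart_dom_open.
Qed.

Lemma Cn_local_map n c d : atlas c -> atlas d -> Cn n (chart_overlap c d) (local_map c d).
Proof. by move=> ac ad; move: n; apply/smooth_onP; exact: (smf.2 c d ac ad). Qed.

Lemma dmapE (x : M) v : 
  dmap f x v = 'D_v (local_map (chart_at x) (chart_at (f x))) (fwd (chart_at x) x).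
Proof.
rewrite deriveE//.
apply: (Cn_diff (Cn_local_map 0 (chart_at_atlas x) (chart_at_atlas (f x)))).
by exists x => //; split; exact: chart_at_in.
Qed.

Lemma derive_local_map c d (x : M) v : atlas c -> atlas d -> chart_dom c x ->
  chart_dom d (f x) ->
  'D_(chart_change (chart_at x) c x v) (local_map c d) (fwd c x) =
  chart_change (chart_at (f x)) d (f x) (dmap f x v).
Proof.
move=> ac ad xc xd.
have [ac' ad'] := (chart_at_atlas x, chart_at_atlas (f x)).
have [xc' xd'] := (chart_at_in x, chart_at_in (f x)).
set c' := chart_at x in ac' xc' *; set d' := chart_at (f x) in ad' xd' *.
rewrite dmapE (chart_changeE ac' ac xc' xc) (chart_changeE ad' ad xd' xd) -/c' -/d'.
have E1 : (fwd c \o bwd c') (fwd c' x) = fwd c x by rewrite /= fwdK.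
have E2 : local_map c' d' (fwd c' x) = fwd d' (f x) by rewrite /local_map /= fwdK.
have d1 : differentiable (fwd c \o bwd c') (fwd c' x) by exact: transition_differentiable.
have d2 : differentiable (local_map c d) ((fwd c \o bwd c') (fwd c' x)).
  by rewrite E1; apply: (Cn_diff (Cn_local_map 0 ac ad)); exists x.
have d3 : differentiable (local_map c' d') (fwd c' x).
  by apply: (Cn_diff (Cn_local_map 0 ac' ad')); exists x.
have d4 : differentiable (fwd d \o bwd d') (local_map c' d' (fwd c' x)).
  by rewrite E2; exact: transition_differentiable.
rewrite -E1 -(derive_comp _ d1 d2).
rewrite -E2 -(derive_comp _ d3 d4).
(* On this open set, inside the source chart at [x], both composites of local representatives with
   transition maps are defined and equal. *)
have oA : open (chart_dom c `&` f @^-1` (chart_dom d `&` chart_dom d')).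
  apply: openI; first exact: chart_dom_open.
  by move/continuousP : smf.1; apply; apply: openI; exact: chart_dom_open.
apply: (derive_eq_on _ (open_chart_part c' oA)); last by exists x.
move=> u; rewrite inE => -[y [yc' [yc [yd yd']]] <-].
by rewrite /local_map /= !fwdK.
Qed.

Lemma dmapD (x : M) v w : dmap f x (v + w) = dmap f x v + dmap f x w.
Proof. exact: linearD. Qed.

Lemma dmapZ (x : M) a v : dmap f x (a *: v) = a *: dmap f x v.
Proof. exact: linearZ. Qed.

Lemma dmap_mx (x : M) v : dmap f x v = v *m lin1_mx (dmap f x).
Proof. by rewrite [RHS]mul_rV_lin1. Qed.

End DMap.

(** * Horizontal lifts *)

Section PointwiseLift.
Context {R : realType} {m p : nat} {M : manifold R m} {N : manifold R p}.
Variables (pi : M -> N) (g : tensor2 M) (x : M).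
Hypotheses (gT : (g x)^T = g x) (gpos : forall v : 'rV[R]_m, v != 0 -> 0 < inner (g x) v v).
Hypothesis sub : submersion pi.

(** Existence is what gives meaning to the choices in [hlift] and [projH]; without it they would
    return the default 0. *)
Lemma horizontal_lift_exists (w : 'rV[R]_p) :
  exists v : 'rV[R]_m, horizontal pi g x v /\ dmap pi x v = w.
Proof.
pose D := lin1_mx (dmap pi x).
have Dsurj (z : 'rV[R]_p) : exists v, v *m D = z.
  by have [v <-] := sub.2 x z; exists v; rewrite [RHS]dmap_mx.
exists (w *m lift_mx D (g x)); split; last first.
  by rewrite dmap_mx -mulmxA (lift_mxK gpos gT Dsurj) mulmx1.
move=> u uv; apply: (lift_mx_horizontal gpos).
by rewrite -[RHS]uv [RHS]dmap_mx.
Qed.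

Lemma vertical_horizontal_eq0 (z : 'rV[R]_m) : vertical pi x z -> horizontal pi g x z -> z = 0.
Proof. by move=> vz hz; apply: (posdef_eq0 gpos); exact: hz. Qed.

Lemma verticalB (v w : 'rV[R]_m) : dmap pi x v = dmap pi x w -> vertical pi x (v - w).
Proof.
move=> E; rewrite /vertical (dmapD pi x v) E -scaleN1r (dmapZ pi x (-1) w).
by rewrite scaleN1r subrr.
Qed.

Lemma horizontalB (v w : 'rV[R]_m) :
  horizontal pi g x v -> horizontal pi g x w -> horizontal pi g x (v - w).
Proof. by move=> hv hw u vu; rewrite innerBl hv// hw// subrr. Qed.

Lemma hlift_spec (W : vfield N) :
  horizontal pi g x (hlift pi g W x) /\ dmap pi x (hlift pi g W x) = W (pi x).
Proof.
have := @xgetPex _ (0 : 'rV[R]_m) [set v : 'rV[R]_m |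
    horizontal pi g x v /\ dmap pi x v = W (pi x)].
by apply; exact: horizontal_lift_exists.
Qed.

Lemma projH_spec (v : 'rV[R]_m) :
  horizontal pi g x (projH pi g x v) /\ dmap pi x (projH pi g x v) = dmap pi x v.
Proof.
have := @xgetPex _ (0 : 'rV[R]_m) [set w : 'rV[R]_m |
    horizontal pi g x w /\ vertical pi x (v - w)].
case.
  have [w [hw dw]] := horizontal_lift_exists (dmap pi x v).
  by exists w; split=> //; exact: verticalB.
move=> h; rewrite /vertical (dmapD pi x v) -scaleN1r (dmapZ pi x (-1)) scaleN1r.
by move=> /eqP; rewrite subr_eq0 => /eqP ->; split.
Qed.

Lemma projV_unique (v w : 'rV[R]_m) : vertical pi x w -> horizontal pi g x (v - w) ->
  projV pi g x v = w.
Proof.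
move=> vw hvw.
have := @xgetPex _ (0 : 'rV[R]_m) [set w : 'rV[R]_m |
    vertical pi x w /\ horizontal pi g x (v - w)].
case; first by exists w.
move=> vz hz; apply/eqP; rewrite -subr_eq0; apply/eqP.
apply: vertical_horizontal_eq0; first by apply: verticalB; rewrite vw.
have := horizontalB hvw hz.
by rewrite opprB addrC addrA subrK.
Qed.

Variables (gN : tensor2 N) (W : 'I_p -> 'rV[R]_p) (E : 'I_p -> 'rV[R]_m).
Hypothesis isom : forall v w : 'rV[R]_m, horizontal pi g x v -> horizontal pi g x w ->
  inner (g x) v w = inner (gN (pi x)) (dmap pi x v) (dmap pi x w).
Hypothesis Worth : forall i j, inner (gN (pi x)) (W i) (W j) = (i == j)%:R.
Hypotheses (hE : forall k, horizontal pi g x (E k)) (dE : forall k, dmap pi x (E k) = W k).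

Lemma frame_orthonormal i j : inner (g x) (E i) (E j) = (i == j)%:R.
Proof. by rewrite isom// !dE Worth. Qed.

(** The inner products of [v] with the frame are those of the horizontal lift of its image, since
    the difference is vertical. By isometry they are the coefficients of that image in the base
    frame. *)
Lemma frame_decomposition (v : 'rV[R]_m) :
  vertical pi x (v - \sum_k inner (g x) v (E k) *: E k).
Proof.
apply: verticalB.
have [h [hh dh]] := horizontal_lift_exists (dmap pi x v).
have -> : dmap pi x (\sum_k inner (g x) v (E k) *: E k) =
    \sum_k inner (g x) v (E k) *: W k.
  by rewrite /dmap linear_sum; apply: eq_bigr => k _; rewrite linearZ -dE.
rewrite [LHS](orthonormal_expansion _ Worth); apply: eq_bigr => k _; congr (_ *: _).
have vvh : vertical pi x (v - h) by exact: verticalB.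
rewrite -[in RHS](subrK h v) innerDl (innerC _ _ gT) hE// add0r.
by rewrite isom// dh dE.
Qed.

Lemma projV_frame (v : 'rV[R]_m) :
  projV pi g x v = v - \sum_k inner (g x) v (E k) *: E k.
Proof.
apply: projV_unique; first exact: frame_decomposition.
rewrite opprB addrCA subrr addr0 => u vu.
by rewrite inner_suml big1// => k _; rewrite innerZl hE// mulr0.
Qed.

End PointwiseLift.

(** * Variations of the metric in charts *)

Lemma Cn_comp_mx {R : realType} (V : normedModType R) n (U : set V) m a b
    (U' : set 'rV[R]_m) (f : V -> 'rV[R]_m) (h : 'rV[R]_m -> 'M[R]_(a, b)) :
  open U -> open U' -> (forall x, U x -> U' (f x)) ->
  Cn n U f -> Cn n U' h -> Cn n U (h \o f).
Proof.
move=> oU oU' UU' Cf /(Cn_mx _ _ oU') Ch; apply/Cn_mx => // i j.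
exact: (Cn_comp oU UU' Cf (Ch i j)).
Qed.

Lemma is_derive_mulmxr {R : realType} a b c (X : R^o -> 'M[R]_(a, b)) (A : 'M[R]_(b, c))
    (t : R^o) X' :
  is_derive t 1 X X' -> is_derive t 1 (fun s => X s *m A) (X' *m A).
Proof.
move=> dX.
have fX : differentiable X t by apply/derivable1_diffP; exact: ex_derive.
have fA : differentiable (fun _ : R^o => A) t by exact: differentiable_cst.
apply: DeriveDef; first by apply: diff_derivable; exact: differentiable_mulmx.
by rewrite (derive_mulmx _ fX fA) !derive_val mulmx0 addr0.
Qed.

Section Family.
Context {R : realType} {m p : nat} {M : manifold R m} {N : manifold R p}.
Variables (g0 : tensor2 M) (gN : tensor2 N) (pi : M -> N) (e : R) (g : R -> tensor2 M).
Hypotheses (g0_metric : riemannian_metric g0) (gN_metric : riemannian_metric gN).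
Hypothesis pi_g0 : riemannian_submersion pi g0 gN.
Hypothesis g_variation : metric_variation pi e g0 g.
Hypothesis pi_g : forall t : R, - e < t < e -> riemannian_submersion pi (g t) gN.
Variable W : 'I_p -> vfield N.
Hypothesis W_smooth : forall i, smooth_field (W i).
Hypothesis W_orthonormal : forall (y : N) i j, inner (gN y) (W i y) (W j y) = (i == j)%:R.

Definition lifted_frame (i : 'I_p) (t : R) : vfield M :=
  fun x => projH pi (g t) x (hlift pi g0 (W i) x).
Local Notation Wt := lifted_frame.

Definition time_domain : set R^o := `]- e, e[%classic.
Local Notation I := time_domain.

Lemma time_domainE (t : R) : I t = (- e < t < e) :> Prop.
Proof. by rewrite /time_domain /= in_itv. Qed.

Lemma open_time_domain : open I.
Proof. exact: interval_open. Qed.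

Let gm (t : R) : I t -> riemannian_metric (g t).
Proof. by rewrite time_domainE; have [h _ _] := g_variation => /h []. Qed.

Lemma family_sym (t : R) x : I t -> (g t x)^T = g t x.
Proof. by move=> /gm [h _ _]; exact: h. Qed.

Lemma family_pos (t : R) x (v : 'rV[R]_m) : I t -> v != 0 -> 0 < inner (g t x) v v.
Proof. by move=> /gm [_ h _]; exact: h. Qed.

Let sub : submersion pi := pi_g0.1.

(** Projecting changes the lift by a vertical vector only, so its image in N is the same at all
    times. *)
Lemma lifted_frame_spec k (t : R) x : I t ->
  horizontal pi (g t) x (Wt k t x) /\ dmap pi x (Wt k t x) = W k (pi x).
Proof.
move=> It.
have [g0T g0pos _] := g0_metric.
have [_ <-] := hlift_spec (g0T x) (@g0pos x) sub (W k).
by have [hh dh] := projH_spec (family_sym x It) (fun v => @family_pos t x v It) sub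
  (hlift pi g0 (W k) x).
Qed.

Lemma family_isometry (t : R) x (v w : 'rV[R]_m) : I t ->
  horizontal pi (g t) x v -> horizontal pi (g t) x w ->
  inner (g t x) v w = inner (gN (pi x)) (dmap pi x v) (dmap pi x w).
Proof. by rewrite time_domainE => /pi_g [_ h]; exact: h. Qed.

Section InCharts.
Variables (c : chart R m M) (d : chart R p N).
Hypotheses (ac : atlas c) (ad : atlas d).

Local Notation U := (chart_overlap pi c d).
Local Notation Phi := (local_map pi c d).
Local Notation Y := (chart_image d).
Local Notation O := (I `*` U).
Local Notation TV := (R^o * 'rV[R]_m)%type.

Definition chart_metric (z : TV) : 'M[R]_m := local_gram c (g z.1) z.2.
Definition chart_frame (k : 'I_p) (z : TV) : 'rV[R]_m := local_field c (Wt k z.1) z.2.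
Definition chart_base_frame (k : 'I_p) : 'rV[R]_p -> 'rV[R]_p := local_field d (W k).
(** The structure functions of the frame: by orthonormality an inner product reads off each
    coefficient of a bracket. In this form their smoothness is visible. *)
Definition chart_coef (a b k : 'I_p) (y : 'rV[R]_p) : R^o :=
  inner (local_gram d gN y) (bracket (chart_base_frame a) (chart_base_frame b) y)
    (chart_base_frame k y).
Local Notation G := chart_metric.
Local Notation F := chart_frame.
Local Notation w := chart_base_frame.
Local Notation cc := chart_coef.

Lemma open_U : open U.
Proof. exact: open_chart_overlap sub.1 c d. Qed.

Lemma open_O : open O.
Proof. exact: openX open_time_domain open_U. Qed.

Lemma open_Y : open Y.
Proof. exact: chart_image_open. Qed.

Lemma sub_image : U `<=` chart_image c.
Proof. by move=> _ [x [xc _] <-]; exists x. Qed.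

Lemma Phi_Y u : U u -> Y (Phi u).
Proof. by move=> [x [xc xd] <-]; exists (pi x) => //; rewrite /local_map /= fwdK. Qed.

Lemma Cn_Phi n : Cn n U Phi.
Proof. exact: Cn_local_map sub.1 _ _ _ ac ad. Qed.

Lemma Cn_chart_metric n : Cn n O G.
Proof.
have [_ _ /(_ c ac)/smooth_onP/(_ n)] := g_variation.
by apply: Cn_sub => -[t u] /= [It /sub_image].
Qed.

Lemma Cn_chart_family n (X : R -> vfield M) : smooth_field_family e X ->
  Cn n O (fun z : TV => local_field c (X z.1) z.2).
Proof.
move=> /(_ c ac)/smooth_onP/(_ n).
by apply: Cn_sub => -[t u] /= [It /sub_image].
Qed.

Lemma Cn_base_frame n k : Cn n Y (w k).
Proof. by have /smooth_onP/(_ n) := W_smooth k ad. Qed.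

Lemma chart_metric_sym z : O z -> (G z)^T = G z.
Proof.
case: z => t u [It _]; rewrite /chart_metric /local_gram /= !trmx_mul trmxK.
by rewrite (family_sym _ It) mulmxA.
Qed.

Section AtPoint.
Variable x : M.
Hypotheses (xc : chart_dom c x) (xd : chart_dom d (pi x)).
Local Notation u := (fwd c x).
Local Notation L := (chart_change (chart_at x) c x).
Local Notation L' := (chart_change c (chart_at x) x).

Lemma U_fwd : U u. Proof. by exists x. Qed.

Lemma toK : cancel L L'.
Proof. exact: chart_changeK (chart_at_atlas x) ac (chart_at_in x) xc. Qed.

Lemma ofK : cancel L' L.
Proof. exact: chart_changeK ac (chart_at_atlas x) xc (chart_at_in x). Qed.

Lemma Phi_fwd : Phi u = fwd d (pi x).
Proof. by rewrite /local_map /= fwdK. Qed.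

Lemma inner_chart_metric (t : R) (v v' : 'rV[R]_m) : inner (G (t, u)) (L v) (L v') = inner (g t x) v v'.
Proof. exact: inner_local_gram_at. Qed.

Lemma chart_frame_at k (t : R) : F k (t, u) = L (Wt k t x).
Proof. exact: local_field_at. Qed.

Lemma derive_Phi (v : 'rV[R]_m) : 'D_(L v) Phi u = chart_change (chart_at (pi x)) d (pi x) (dmap pi x v).
Proof. exact: (derive_local_map sub.1). Qed.

Lemma vertical_chart (v : 'rV[R]_m) : vertical pi x v <-> 'D_(L v) Phi u = 0.
Proof.
rewrite derive_Phi; split=> [->|].
  by rewrite /chart_change linear0.
move=> /(congr1 (chart_change d (chart_at (pi x)) (pi x))).
rewrite chart_changeK//; try by [exact: chart_at_atlas|exact: chart_at_in].
by rewrite /chart_change linear0.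
Qed.

Lemma vertical_of (a : 'rV[R]_m) : 'D_a Phi u = 0 -> vertical pi x (L' a).
Proof. by move=> av; apply/vertical_chart; rewrite ofK. Qed.

Lemma chart_frame_related k (t : R) : I t -> 'D_(F k (t, u)) Phi u = w k (Phi u).
Proof.
move=> It; rewrite chart_frame_at derive_Phi (lifted_frame_spec k x It).2.
by rewrite Phi_fwd /chart_base_frame local_field_at.
Qed.

Lemma chart_frame_orthonormal a b (t : R) : I t ->
  inner (G (t, u)) (F a (t, u)) (F b (t, u)) = (a == b)%:R.
Proof.
move=> It; rewrite !chart_frame_at inner_chart_metric.
apply: (frame_orthonormal (W := fun k => W k (pi x)) (pi := pi) (gN := gN)
  (E := fun k => Wt k t x)).
- by move=> v v'; exact: family_isometry.
- exact: W_orthonormal.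
- by move=> k; exact: (lifted_frame_spec k x It).1.
- by move=> k; exact: (lifted_frame_spec k x It).2.
Qed.

Lemma chart_frame_horizontal k (t : R) v : I t -> 'D_v Phi u = 0 ->
  inner (G (t, u)) (F k (t, u)) v = 0.
Proof.
move=> It /vertical_of v0; rewrite chart_frame_at -(ofK v) inner_chart_metric.
exact: (lifted_frame_spec k x It).1.
Qed.

Lemma chart_frame_decomposition (t : R) v : I t ->
  'D_(v - \sum_k inner (G (t, u)) v (F k (t, u)) *: F k (t, u)) Phi u = 0.
Proof.
move=> It.
have := @frame_decomposition R m p M N pi (g t) x (family_sym x It)
  (fun v => @family_pos t x v It) sub gN (fun k => W k (pi x)) (fun k => Wt k t x)
  (fun v v' => @family_isometry t x v v' It) (W_orthonormal (pi x))
  (fun k => (lifted_frame_spec k x It).1) (fun k => (lifted_frame_spec k x It).2) (L' v).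
move=> /vertical_chart; congr ('D_ _ Phi u = 0).
have LB a b : L (a - b) = L a - L b by rewrite /chart_change linearB.
have Lsum (f : 'I_p -> 'rV[R]_m) : L (\sum_k f k) = \sum_k L (f k).
  by rewrite /chart_change linear_sum.
rewrite LB ofK Lsum; congr (_ - _); apply: eq_bigr => k _.
by rewrite chart_changeZ -inner_chart_metric ofK chart_frame_at.
Qed.

Lemma chart_metric_pos (t : R) v : I t -> v != 0 -> 0 < inner (G (t, u)) v v.
Proof.
move=> It v0; rewrite -(ofK v) inner_chart_metric family_pos//.
by apply: contra_neq v0 => Lv; rewrite -(ofK v) Lv /chart_change linear0.
Qed.

Lemma Phi_surj (y : 'rV[R]_p) : exists v, 'D_v Phi u = y.
Proof.
have [v dv] := sub.2 x (chart_change d (chart_at (pi x)) (pi x) y).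
exists (L v); rewrite derive_Phi dv chart_changeK//; by [exact: chart_at_atlas|exact: chart_at_in].
Qed.

End AtPoint.

(** The frame is defined through pointwise choices; it inherits smoothness in (t, u) from the
    formula with [lift_mx], which only involves products and inverses of smooth matrices. *)
Lemma Cn_chart_frame n k : Cn n O (F k).
Proof.
have oU := open_U; have oO := open_O.
have dPhi u : U u -> differentiable Phi u by exact: Cn_diff (Cn_Phi 0).
pose D u := lin1_mx ('d Phi u).
have DE u v : U u -> v *m D u = 'D_v Phi u.
  by move=> Uu; rewrite mul_rV_lin1 deriveE//; exact: dPhi.
have CD : Cn n U D.
  apply/Cn_mx => // i j.
  have /(Cn_mx _ _ oU)/(_ 0 j) := Cn_derive (delta_mx 0 i) (Cn_Phi n.+1).
  apply: Cn_eq => // u; rewrite inE => Uu.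
  by rewrite -DE// -rowE mxE.
have Dsurj u : U u -> forall y : 'rV[R]_p, exists v, v *m D u = y.
  move=> Uu y; have [x [xc xd] xu] := Uu; have [v dv] := Phi_surj xc xd y.
  by exists v; rewrite -dv xu DE.
have Gpos z : O z -> forall v, v != 0 -> 0 < inner (G z) v v.
  by case: z => t u0 [/= It [x [xc xd] <-]] v; exact: chart_metric_pos.
have CDO : Cn n O (fun z : TV => D z.2) by exact: Cn_static open_time_domain oU CD.
have CG := Cn_chart_metric n.
have CGi : Cn n O (fun z => invmx (G z)).
  by apply: Cn_invmx => // z Oz; apply: posdef_unitmx; exact: Gpos.
have CDT := Cn_trmx oO CDO.
have CS : Cn n O (fun z : TV => invmx ((D z.2)^T *m invmx (G z) *m D z.2)).
  apply: Cn_invmx => //.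
    move=> z Oz; apply: lift_gram_unitmx (Gpos _ Oz) (chart_metric_sym Oz) _.
    by apply: Dsurj; case: z Oz => ? ? [].
  by do 2?[apply: Cn_mulmx => //].
have Cw : Cn n O (fun z : TV => w k (Phi z.2)).
  apply: (Cn_static (f := fun u => w k (Phi u)) open_time_domain oU).
  exact: (Cn_comp_mx oU open_Y Phi_Y (Cn_Phi n) (Cn_base_frame n k)).
have Clift : Cn n O (fun z : TV => w k (Phi z.2) *m lift_mx (D z.2) (G z)).
  by apply: Cn_mulmx => //; apply: Cn_mulmx => //; exact: Cn_mulmx.
apply: Cn_eq Clift => // -[t u]; rewrite inE => Otu.
have [It Uu] := Otu; have [x [xc xd] xu] := Uu.
have S := Dsurj _ Uu; have P := Gpos _ Otu; have T := chart_metric_sym Otu.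
rewrite /= in It Uu xu S P T *; set lw := _ *m lift_mx _ _.
have lwD : 'D_lw Phi u = w k (Phi u).
  by rewrite -DE// /lw -mulmxA (lift_mxK P T S) mulmx1.
have FD : 'D_(F k (t, u)) Phi u = w k (Phi u) by rewrite -xu; exact: chart_frame_related.
(* Both vectors are horizontal with the same image, so their difference is vertical and horizontal,
   hence zero. *)
have v0 : 'D_(lw - F k (t, u)) Phi u = 0.
  by rewrite derive_dirB; [rewrite lwD FD subrr|exact: dPhi].
apply/eqP; rewrite -subr_eq0; apply/eqP; apply: (posdef_eq0 P).
rewrite innerBl (lift_mx_horizontal P); last by rewrite DE.
by rewrite sub0r -xu chart_frame_horizontal ?oppr0// xu.
Qed.

Lemma chart_coef_expansion a b y : Y y ->
  bracket (w a) (w b) y = \sum_k cc a b k y *: w k y.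
Proof.
move=> [z zd <-]; apply: orthonormal_expansion => i j.
by rewrite /chart_base_frame !local_field_at// inner_local_gram_at.
Qed.

Lemma Cn_chart_coef n a b k : Cn n Y (cc a b k).
Proof.
have oY := open_Y.
have CH : Cn n Y (local_gram d gN).
  by have [_ _ /(_ d ad)/smooth_onP/(_ n)] := gN_metric.
have Cb : Cn n Y (bracket (w a) (w b)).
  by apply: CnB => //; apply: Cn_derive_field => //; exact: Cn_base_frame.
have : Cn n Y (fun y => bracket (w a) (w b) y *m local_gram d gN y *m (w k y)^T).
  apply: Cn_mulmx => //; first exact: Cn_mulmx.
  by apply: Cn_trmx => //; exact: Cn_base_frame.
by move/(Cn_mx _ _ oY)/(_ 0 0).
Qed.

Definition frame_vbracket (i j : 'I_p) (t : R) (u : 'rV[R]_m) : 'rV[R]_m :=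
  vbracket Phi cc (fun k v => F k (t, v)) i j u.

(** * O'Neill's formula at a fixed time *)

Section Slice.
Variable t : R.
Hypothesis It : I t.
Local Notation Gt := (fun v => G (t, v)).
Local Notation Ft := (fun k v => F k (t, v)).

Let sG n : Cn n U Gt. Proof. exact: Cn_slice open_U It (Cn_chart_metric n). Qed.

Let sF n k : Cn n U (Ft k). Proof. exact: Cn_slice open_U It (Cn_chart_frame n k). Qed.

Let GT u : U u -> (G (t, u))^T = G (t, u).
Proof. by move=> Uu; apply: chart_metric_sym. Qed.

Let Gpos u (v : 'rV[R]_m) : U u -> v != 0 -> 0 < inner (G (t, u)) v v.
Proof. by move=> [x [xc xd] <-]; exact: chart_metric_pos. Qed.

Let Fw k u : U u -> 'D_(F k (t, u)) Phi u = w k (Phi u).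
Proof. by move=> [x [xc xd] <-]; exact: chart_frame_related. Qed.

Let Fo a b u : U u -> inner (G (t, u)) (F a (t, u)) (F b (t, u)) = (a == b)%:R.
Proof. by move=> [x [xc xd] <-]; exact: chart_frame_orthonormal. Qed.

Let Fh k u (v : 'rV[R]_m) : U u -> 'D_v Phi u = 0 -> inner (G (t, u)) (F k (t, u)) v = 0.
Proof. by move=> [x [xc xd] <-]; exact: chart_frame_horizontal. Qed.

Let Fdec u (v : 'rV[R]_m) : U u ->
  'D_(v - \sum_k inner (G (t, u)) v (F k (t, u)) *: F k (t, u)) Phi u = 0.
Proof. by move=> [x [xc xd] <-]; exact: chart_frame_decomposition. Qed.

Lemma frame_vbracket_vertical i j u : U u -> 'D_(frame_vbracket i j t u) Phi u = 0.
Proof.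
exact: (vbracket_vertical open_U Cn_Phi Phi_Y Cn_base_frame chart_coef_expansion sF Fw i j).
Qed.

Lemma inner_frame_bracket i j k u : U u ->
  inner (G (t, u)) (bracket (Ft i) (Ft j) u) (F k (t, u)) = cc i j k (Phi u).
Proof.
exact: (inner_bracket_frame (G := Gt) open_U GT Cn_Phi Phi_Y Cn_base_frame
  chart_coef_expansion sF Fw Fo Fh i j k).
Qed.

Lemma frame_curvature i j u : U u ->
  inner (G (t, u)) (curv Gt (fun=> F i (t, u)) (fun=> F j (t, u)) (fun=> F j (t, u)) u)
    (F i (t, u)) =
  base_curvature w cc i j (Phi u)
  - 3 / 4 * inner (G (t, u)) (frame_vbracket i j t u) (frame_vbracket i j t u).
Proof.
move=> Uu.
have Gu v : U v -> Gt v \in unitmx by move=> Uv; apply: posdef_unitmx => z; exact: Gpos.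
rewrite -(curv_tensorial open_U sG Gu Uu (sF 2 i) (sF 2 j) (sF 2 j)).
exact: (oneill (G := Gt) open_U sG GT Gpos Cn_Phi Phi_Y Cn_base_frame Cn_chart_coef
  chart_coef_expansion sF Fw Fo Fh Fdec i j Uu).
Qed.

End Slice.

(** * Time derivatives of the lifted frame and of its brackets *)

Variable V : 'I_p -> R -> vfield M.
Hypothesis V_smooth : forall i, smooth_field_family e (V i).
Hypothesis V_vertical : forall i (t : R), - e < t < e -> vertical_field pi (V i t).
Hypothesis B_sharp : forall (t : R) (x : M) (X : tangent x), - e < t < e -> vertical pi x X ->
  sharp (g t) x (dt_tensor2 g t X)
  = \sum_(i < p) inner (g0 x) (V i t x) X *: (Wt i t x : 'rV[R]_m).

Definition chart_variation (k : 'I_p) (z : TV) : 'rV[R]_m := local_field c (V k z.1) z.2.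
Local Notation Vl := chart_variation.

Lemma Cn_chart_variation n k : Cn n O (Vl k).
Proof. exact: Cn_chart_family. Qed.

Lemma chart_variation_at x k (t : R) : chart_dom c x ->
  Vl k (t, fwd c x) = chart_change (chart_at x) c x (V k t x).
Proof. exact: local_field_at. Qed.

(* The hypothesis on [sharp] in the form B_t(X, W_k^t) = g_t(V_k, X) for X vertical. *)
Lemma dt_metric_frame x k (t : R) (v : 'rV[R]_m) : chart_dom c x -> chart_dom d (pi x) ->
  I t -> 'D_v Phi (fwd c x) = 0 ->
  inner ('D_dt G (t, fwd c x)) v (F k (t, fwd c x)) =
  inner (G (t, fwd c x)) (Vl k (t, fwd c x)) v.
Proof.
move=> xc xd It v0.
set u := fwd c x; set L := chart_change (chart_at x) c x.
set X : 'rV[R]_m := chart_change c (chart_at x) x v.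
have LX : L X = v by exact: ofK.
have vX : vertical pi x X by exact: vertical_of.
have Otu : O (t, u) by split=> //; exact: U_fwd.
have dG := Cn_diff (Cn_chart_metric 0) Otu.
have bE (y : 'rV[R]_m) : dt_tensor2 g t (x := x) X y = inner ('D_dt G (t, u)) v (L y).
  rewrite /dt_tensor2 derive1E.
  have gE : (fun s : R^o => inner (g s x) X y : R^o) =
      (fun s : R^o => inner (G (s, u)) v (L y) : R^o).
    by apply/funext => s; rewrite -LX -inner_chart_metric.
  rewrite gE.
  have dGt := is_derive_time dG.
  have fG : differentiable (fun s : R^o => G (s, u)) (t : R^o).
    by apply/derivable1_diffP; exact: ex_derive.
  have fc (a : 'rV[R]_m) : differentiable (fun _ : R^o => a) (t : R^o).
    exact: differentiable_cst.
  rewrite (derive_inner (1 : R^o) fG (fc v) (fc (L y))) !derive_val.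
  by rewrite inner0l inner0r !addr0.
have Gu : G (t, u) \in unitmx.
  by apply: posdef_unitmx => a; exact: chart_metric_pos.
(* [sharp] is a choice as well; the witness is obtained by applying the inverse Gram matrix in the
   chart [c] and going back to the coordinates of [chart_at x]. *)
have sharpE (y : 'rV[R]_m) :
    inner (g t x) (sharp (g t) x (dt_tensor2 g t (x := x) X)) y = dt_tensor2 g t (x := x) X y.
  have := @xgetPex _ (0 : 'rV[R]_m) [set s : 'rV[R]_m |
    forall y : tangent x, inner (g t x) s y = dt_tensor2 g t (x := x) X y].
  apply; exists (chart_change c (chart_at x) x (v *m 'D_dt G (t, u) *m invmx (G (t, u)))).
  move=> a; rewrite bE -(inner_chart_metric xc) -/u ofK//.
  by rewrite /inner mulmxKV.
have tI := It; rewrite time_domainE in tI.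
rewrite chart_frame_at// -/L -bE -sharpE (B_sharp tI vX) inner_suml (bigD1 k)//=.
rewrite innerZl -(inner_chart_metric xc) -!(chart_frame_at xc) chart_frame_orthonormal//.
rewrite eqxx mulr1 big1 ?addr0.
  (* The hypothesis pairs [V k] and [X] by [g0]; both are vertical, where [g0] and [g t]
     coincide. *)
  have [/(_ t tI)[_ gg0] _ _] := g_variation.
  rewrite -gg0//; last exact: V_vertical.
  by rewrite -(inner_chart_metric xc) -/L LX chart_variation_at.
move=> i ik; rewrite innerZl -(inner_chart_metric xc) -!(chart_frame_at xc).
by rewrite chart_frame_orthonormal// (negbTE ik) mulr0.
Qed.

(** The sum [z] of the derivative and of [Vl k] is vertical; tested against vertical vectors it
    vanishes, and [z] itself is a legitimate test vector. *)
Lemma derive_chart_frame k (t : R) u : O (t, u) -> 'D_dt (F k) (t, u) = - Vl k (t, u).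
Proof.
move=> Otu; have [/= It Uu] := Otu; have [x [xc xd] xu] := Uu.
have dPhi : differentiable Phi u by exact: Cn_diff (Cn_Phi 0) Uu.
have dF := is_derive_time (Cn_diff (Cn_chart_frame 0 k) Otu).
have dG := is_derive_time (Cn_diff (Cn_chart_metric 0) Otu).
have fF : differentiable (fun s : R^o => F k (s, u)) (t : R^o).
  by apply/derivable1_diffP; exact: ex_derive.
have fG : differentiable (fun s : R^o => G (s, u)) (t : R^o).
  by apply/derivable1_diffP; exact: ex_derive.
set f' := 'D_dt (F k) (t, u) in dF *.
have oI := open_time_domain.
(* The image of the frame under the differential of Phi is w_k (Phi u) at all times, and a linear
   map commutes with the time derivative. *)
have vf' : 'D_f' Phi u = 0.
  pose D := lin1_mx ('d Phi u).
  have DE v : v *m D = 'D_v Phi u by rewrite mul_rV_lin1 deriveE.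
  have dFD := is_derive_mulmxr D dF.
  have dcst : is_derive (t : R^o) 1 (fun _ : R^o => w k (Phi u)) (f' *m D).
    apply: near_eq_is_derive dFD; apply: filterS (open_nbhs_nbhs (conj oI It)) => s Is.
    by rewrite DE -xu chart_frame_related.
  by rewrite -DE -(@derive_val _ _ _ _ _ _ _ dcst); exact: derive_cst.
(* The time derivative of g_t(F_k, v) = 0, with [v] held fixed: the vertical space does not depend
   on time. *)
have Eq1 v : 'D_v Phi u = 0 ->
    inner ('D_dt G (t, u)) (F k (t, u)) v + inner (G (t, u)) f' v = 0.
  move=> v0.
  have fv : differentiable (fun _ : R^o => v) (t : R^o) by exact: differentiable_cst.
  have := derive_inner (1 : R^o) fG fF fv; rewrite !derive_val inner0r addr0 => <-.
  rewrite -[RHS](derive_cst (0 : R^o) (t : R^o) 1).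
  apply: (derive_eq_on _ oI) => // s; rewrite inE => Is.
  by rewrite -xu chart_frame_horizontal// xu.
have G'T : ('D_dt G (t, u))^T = 'D_dt G (t, u).
  rewrite -derive_trmx; last exact: Cn_diff (Cn_chart_metric 0) Otu.
  by apply: (derive_eq_on _ open_O) => // z; rewrite inE => /chart_metric_sym.
have vV : 'D_(Vl k (t, u)) Phi u = 0.
  rewrite -xu chart_variation_at//; apply/vertical_chart => //.
  by apply: V_vertical; rewrite -time_domainE.
set z := f' + Vl k (t, u).
have vz : 'D_z Phi u = 0 by rewrite derive_dirD// vf' vV addr0.
suff : z = 0 by move=> /eqP; rewrite addr_eq0 => /eqP.
apply: (posdef_eq0 (G := G (t, u))).
  by move=> a; rewrite -xu; exact: chart_metric_pos.
rewrite {1}/z innerDl.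
have := dt_metric_frame k xc xd It; rewrite xu => /(_ z vz) <-.
by rewrite addrC (innerC z _ G'T) Eq1.
Qed.

Definition mixed_bracket (i j : 'I_p) (t : R) u : 'rV[R]_m :=
  bracket (fun v => Vl i (t, v)) (fun v => F j (t, v)) u
  + bracket (fun v => F i (t, v)) (fun v => Vl j (t, v)) u.

Lemma chart_slice_differentiable q (X : TV -> 'rV[R]_q) (t : R) u :
  Cn 0 O X -> O (t, u) -> differentiable (fun v => X (t, v)) u.
Proof. by move=> CX [/= It Uu]; exact: Cn_diff (Cn_slice open_U It CX) Uu. Qed.

Lemma is_derive_frame_bracket i j (t : R) u : O (t, u) ->
  is_derive (t : R^o) 1
    (fun s : R^o => bracket (fun v => F i (s, v)) (fun v => F j (s, v)) u)
    (- mixed_bracket i j t u).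
Proof.
move=> Otu; have [/= It Uu] := Otu.
have dF k := chart_slice_differentiable (Cn_chart_frame 0 k) Otu.
have dV k := chart_slice_differentiable (Cn_chart_variation 0 k) Otu.
have FV k : {in U, (fun v => 'D_dt (F k) (t, v)) =1 (fun v => - Vl k (t, v))}.
  by move=> v; rewrite inE => Uv; exact: derive_chart_frame.
apply: is_derive_eq (is_derive_time_bracket open_time_domain open_U It Uu
  (Cn_chart_frame 2 i) (Cn_chart_frame 2 j)) _.
rewrite (bracket_eq_on open_U Uu (FV i) (fun v _ => erefl)).
rewrite (bracket_eq_on open_U Uu (fun v _ => erefl) (FV j)).
rewrite (bracketNl (dV i) (dF j)) (bracketNr (dF i) (dV j)).
exact: esym (opprD _ _).
Qed.

(** Each of the two brackets contains one frame field, whose derivative is minus the corresponding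
    V; both produce the same -[V_i, V_j], hence the factor 2. *)
Lemma is_derive_mixed_bracket i j (t : R) u : O (t, u) ->
  is_derive (t : R^o) 1 (fun s : R^o => mixed_bracket i j s u)
    (bracket (fun v => 'D_dt (Vl i) (t, v)) (fun v => F j (t, v)) u
     + bracket (fun v => F i (t, v)) (fun v => 'D_dt (Vl j) (t, v)) u
     - 2 *: bracket (fun v => Vl i (t, v)) (fun v => Vl j (t, v)) u).
Proof.
move=> Otu; have [/= It Uu] := Otu.
have dV k := chart_slice_differentiable (Cn_chart_variation 0 k) Otu.
have FV k : {in U, (fun v => 'D_dt (F k) (t, v)) =1 (fun v => - Vl k (t, v))}.
  by move=> v; rewrite inE => Uv; exact: derive_chart_frame.
have d1 := is_derive_time_bracket open_time_domain open_U It Uu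
  (Cn_chart_variation 2 i) (Cn_chart_frame 2 j).
have d2 := is_derive_time_bracket open_time_domain open_U It Uu
  (Cn_chart_frame 2 i) (Cn_chart_variation 2 j).
apply: is_derive_eq (is_deriveD d1 d2) _.
rewrite (bracket_eq_on open_U Uu (fun v _ => erefl) (FV j)).
rewrite (bracket_eq_on open_U Uu (FV i) (fun v _ => erefl)).
rewrite (bracketNr (dV i) (dV j)) (bracketNl (dV i) (dV j)).
have arrange (a b z : 'rV[R]_m) : a - z + (- z + b) = a + b - 2 *: z.
  by rewrite scaler_nat mulr2n opprD [- z + b]addrC addrACA.
exact: arrange.
Qed.

(** The coefficients of the horizontal part live on the base and are constant in time, so only the
    frame fields in it are differentiated. *)
Lemma is_derive_frame_vbracket i j (t : R) u : O (t, u) ->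
  is_derive (t : R^o) 1 (fun s : R^o => frame_vbracket i j s u)
    (\sum_k cc i j k (Phi u) *: Vl k (t, u) - mixed_bracket i j t u).
Proof.
move=> Otu.
have dF k : is_derive (t : R^o) 1 (fun s : R^o => F k (s, u)) (- Vl k (t, u)).
  rewrite -(derive_chart_frame k Otu); apply: is_derive_time.
  exact: Cn_diff (Cn_chart_frame 0 k) Otu.
have dsum : is_derive (t : R^o) 1
    (\sum_k (fun s : R^o => cc i j k (Phi u) *: F k (s, u)))
    (\sum_k cc i j k (Phi u) *: - Vl k (t, u)).
  by apply: is_derive_sum => k; exact: is_deriveZ (dF k).
have := is_deriveB (is_derive_frame_bracket i j Otu) dsum.
rewrite (_ : _ - \sum_k _ = fun s : R^o => frame_vbracket i j s u); last first.
  by apply/funext => s; rewrite !fctE fct_sumE.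
move=> dA; apply: is_derive_eq dA _.
rewrite addrC -sumrN; congr (_ - _).
by apply: eq_bigr => k _; rewrite scalerN opprK.
Qed.

(** The chart change at [x] is linear and independent of time, so it commutes with the time
    derivative. *)
Lemma local_field_dt_field k x (t : R) : chart_dom c x -> chart_dom d (pi x) -> I t ->
  local_field c (dt_field (V k) t) (fwd c x) = 'D_dt (Vl k) (t, fwd c x).
Proof.
move=> xc xd It; rewrite local_field_at// /dt_field derive1E.
have Otu : O (t, fwd c x) by split=> //; exact: U_fwd.
have dV := is_derive_mulmxr (lin1_mx (chart_change c (chart_at x) x))
  (is_derive_time (Cn_diff (Cn_chart_variation 0 k) Otu)).
have VE : (fun s : R^o => (V k s x : 'rV[R]_m)) =
    (fun s : R^o => Vl k (s, fwd c x) *m lin1_mx (chart_change c (chart_at x) x)).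
  by apply/funext => s; rewrite -chart_change_mx chart_variation_at// toK.
by rewrite VE (@derive_val _ _ _ _ _ _ _ dV) -chart_change_mx ofK.
Qed.

End InCharts.

(** * Evaluation in the distinguished chart, where the chart change at the point is the identity *)

Section AtCenter.
Variable x : M.
Local Notation c := (chart_at x).
Local Notation d := (chart_at (pi x)).
Local Notation u := (fwd c x).
Local Notation Phi := (local_map pi c d).
Let ac := chart_at_atlas x.
Let ad := chart_at_atlas (pi x).
Let xc := chart_at_in x.
Let xd := chart_at_in (pi x).

Lemma center_metric (t : R) (v v' : 'rV[R]_m) :
  inner (chart_metric c (t, u)) v v' = inner (g t x) v v'.
Proof.
have := inner_chart_metric ac xc t v v'.
by rewrite !(chart_change_id _ ac xc).
Qed.

Lemma center_frame k (t : R) : chart_frame c k (t, u) = Wt k t x.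
Proof. by rewrite (chart_frame_at xc) (chart_change_id _ ac xc). Qed.

Lemma center_vertical (v : 'rV[R]_m) : 'D_v Phi u = 0 -> vertical pi x v.
Proof.
have := vertical_chart ac ad xc xd v.
by rewrite (chart_change_id _ ac xc) => -[_].
Qed.

Lemma center_coef i j k :
  chart_coef d i j k (Phi u) =
  inner (gN (pi x)) (lie_bracket (W i) (W j) (pi x)) (W k (pi x)).
Proof.
rewrite (Phi_fwd d xc) /chart_coef /chart_base_frame (local_field_at (W k) xd).
rewrite -(inner_local_gram_at gN (lie_bracket (W i) (W j) (pi x)) _ ad xd).
by congr (inner _ _ _); rewrite (chart_change_id _ ad xd).
Qed.

Lemma center_projV i j (t : R) : I t ->
  projV pi (g t) x (lie_bracket (Wt i t) (Wt j t) x) = frame_vbracket c d i j t u.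
Proof.
move=> It.
rewrite (projV_frame (family_sym x It) (fun v => @family_pos t x v It) sub
  (fun v v' => @family_isometry t x v v' It) (W_orthonormal (pi x))
  (fun k => (lifted_frame_spec k x It).1) (fun k => (lifted_frame_spec k x It).2)).
congr (_ - _); apply: eq_bigr => k _.
rewrite -center_frame -center_metric; congr (_ *: _).
exact: (inner_frame_bracket ac ad It i j k (U_fwd xc xd)).
Qed.

(** Orthonormality of the frame and i != j make the denominator of [sec] equal to 1. *)
Lemma sec_lifted_frame (i j : 'I_p) (t : R) : i != j -> I t ->
  sec (g t) x (Wt i t x) (Wt j t x) =
  base_curvature (chart_base_frame d) (chart_coef d) i j (Phi u)
  - 3 / 4 * inner (g t x) (frame_vbracket c d i j t u) (frame_vbracket c d i j t u).
Proof.
move=> ij It.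
have orth a b : inner (g t x) (Wt a t x) (Wt b t x) = (a == b)%:R.
  by rewrite -!center_frame -center_metric (chart_frame_orthonormal ac xc a b It).
rewrite /sec !orth !eqxx (negbTE ij) mulr1 expr0n subr0 divr1.
rewrite -!center_metric -(frame_curvature ac ad It i j (U_fwd xc xd)).
by rewrite !center_frame.
Qed.

(** The argument is vertical, and every metric of the family restricts to [g0] there. The norm can
    thus be taken in one fixed metric while its argument moves. *)
Lemma center_vbracket_norm i j (t s : R) : I t -> I s ->
  inner (g s x) (frame_vbracket c d i j s u) (frame_vbracket c d i j s u) =
  inner (g t x) (frame_vbracket c d i j s u) (frame_vbracket c d i j s u).
Proof.
move=> It Is.
have vA : vertical pi x (frame_vbracket c d i j s u).
  by apply: center_vertical; exact: (frame_vbracket_vertical ac ad Is i j (U_fwd xc xd)).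
rewrite time_domainE in It; rewrite time_domainE in Is.
have [Rg _ _] := g_variation.
by rewrite (Rg _ Is).2// (Rg _ It).2.
Qed.

End AtCenter.
End Family.

Unset Implicit Arguments.

Theorem theorem4p3 (R : realType) (n p : nat)
    (M : manifold R (n + p)) (N : manifold R p)
    (M_connected : connected [set: M]) (N_connected : connected [set: N])
    (oM : M -> bool) (M_oriented : orientation oM)
    (oN : N -> bool) (N_oriented : orientation oN)
    (g0 : tensor2 M) (gN : tensor2 N) (pi : M -> N)
    (g0_metric : riemannian_metric g0) (gN_metric : riemannian_metric gN)
    (pi_g0 : riemannian_submersion pi g0 gN)
    (e : R) (e_gt0 : 0 < e) (g : R -> tensor2 M)
    (g_variation : metric_variation pi e g0 g)
    (pi_g : forall t : R, - e < t < e -> riemannian_submersion pi (g t) gN)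
    (W : 'I_p -> vfield N) (W_smooth : forall i, smooth_field (W i))
    (W_orthonormal : forall (y : N) i j,
       inner (gN y) (W i y) (W j y) = (i == j)%:R)
    (V : 'I_p -> R -> vfield M)
    (V_smooth : forall i, smooth_field_family e (V i))
    (V_vertical : forall i (t : R), - e < t < e -> vertical_field pi (V i t)) :
  let Wt (i : 'I_p) (t : R) : vfield M :=
    fun x => projH pi (g t) x (hlift pi g0 (W i) x) in
  (forall (t : R) (x : M) (X : tangent x), - e < t < e -> vertical pi x X ->
     sharp (g t) x (dt_tensor2 g t X)
     = \sum_(i < p) inner (g0 x) (V i t x) X *: (Wt i t x : 'rV[R]_(n + p))) ->
  forall (i j : 'I_p) (t : R) (x : M), i != j -> - e < t < e ->
  let c (k : 'I_p) : R :=
    inner (gN (pi x)) (lie_bracket (W i) (W j) (pi x)) (W k (pi x)) in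
  let gt := inner (g t x) in
  let dV k := dt_field (V k) t in
  let A := projV pi (g t) x (lie_bracket (Wt i t) (Wt j t) x) in
  let S := field_add (lie_bracket (V i t) (Wt j t))
                     (lie_bracket (Wt i t) (V j t)) x in
  let dS := field_add (lie_bracket (dV i) (Wt j t))
                      (lie_bracket (Wt i t) (dV j)) x in
  let secW (s : R^o) : R^o := sec (g s) x (Wt i s x) (Wt j s x) in
  is_derive (t : R^o) 1 secW
    (- (3 / 2) * \sum_(k < p) c k * gt (V k t x) A + 3 / 2 * gt S A)
  /\
  is_derive (t : R^o) 1 (derive1 secW)
    (- (3 / 2) * \sum_(k < p) c k * gt (dV k x) A
     - 3 / 2 * \sum_(k < p) \sum_(l < p) c k * c l * gt (V k t x) (V l t x)
     + 3 * \sum_(k < p) c k * gt (V k t x) S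
     + 3 / 2 * gt dS A
     - 3 * gt (lie_bracket (V i t) (V j t) x) A
     - 3 / 2 * gt S S).
Proof.
move=> Wt B_sharp i j t x ij tI c gt dV A S dS secW.
have It : time_domain e t by rewrite time_domainE.
pose ch := chart_at x; pose d := chart_at (pi x); pose u := fwd ch x.
have ac : atlas ch := chart_at_atlas x.
have ad : atlas d := chart_at_atlas (pi x).
have xc : chart_dom ch x := chart_at_in x.
have xd : chart_dom d (pi x) := chart_at_in (pi x).
have Uu : chart_overlap pi ch d u by exists x.
have O_ (s : R) : time_domain e s -> (time_domain e `*` chart_overlap pi ch d) (s, u) by [].
have oI := @open_time_domain R e.
have oU : open (chart_overlap pi ch d)
  := @open_U _ _ _ _ _ _ _ _ pi_g0 ch d.
pose F k z := chart_frame g0 pi g W ch k z.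
pose Vl k z := chart_variation ch V k z.
have VuE k (s : R) : Vl k (s, u) = V k s x.
  by rewrite /Vl chart_variation_at// chart_change_id.
have dVu k : is_derive (t : R^o) 1 (fun s : R^o => Vl k (s, u)) ('D_dt (Vl k) (t, u)).
  apply: is_derive_time.
  exact: Cn_diff (Cn_chart_variation pi d ac V_smooth 0 k) (O_ t It).
(* Equality on the whole overlap and not only at [u], because the field dV is differentiated once
   more inside the brackets of [dS]. *)
have dVlocal k : {in chart_overlap pi ch d,
    (fun v => 'D_dt (Vl k) (t, v)) =1 local_field ch (dV k)}.
  move=> v; rewrite inE => -[y [yc yd] <-].
  exact: esym (local_field_dt_field ac V_smooth k yc yd It).
have dVx k : 'D_dt (Vl k) (t, u) = dV k x.
  by rewrite (dVlocal k _ (mem_set Uu)) local_field_at// chart_change_id.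
have AE : A = frame_vbracket g0 gN pi g W ch d i j t u.
  exact: (center_projV g0_metric pi_g0 g_variation pi_g W_smooth W_orthonormal x i j It).
have cE k : chart_coef gN W d i j k (local_map pi ch d u) = c k by exact: center_coef.
have SE : S = mixed_bracket g0 pi g W ch V i j t u by [].
have dSE : dS = bracket (local_field ch (dV i)) (fun v => F j (t, v)) u
    + bracket (fun v => F i (t, v)) (local_field ch (dV j)) u := erefl _.
(* The time [t] is fixed in the metric while [s] varies, so that the metric is a constant when
   differentiating in [s]. *)
have secE (s : R^o) : time_domain e s -> secW s =
    base_curvature (chart_base_frame W d) (chart_coef gN W d) i j (local_map pi ch d u)
    - 3 / 4 * inner (g t x) (frame_vbracket g0 gN pi g W ch d i j s u)
        (frame_vbracket g0 gN pi g W ch d i j s u).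
  move=> Is.
  rewrite -(center_vbracket_norm g0_metric pi_g0 g_variation W_smooth W_orthonormal x i j It Is).
  exact: (sec_lifted_frame g0_metric gN_metric pi_g0 g_variation pi_g W_smooth
    W_orthonormal x ij Is).
have dA (s : R^o) : time_domain e s ->
    is_derive s 1 (fun s => frame_vbracket g0 gN pi g W ch d i j s u)
      (\sum_k c k *: Vl k (s, u) - mixed_bracket g0 pi g W ch V i j s u).
  move=> Is.
  have := is_derive_frame_vbracket g0_metric pi_g0 g_variation pi_g W_smooth
    W_orthonormal ac ad V_smooth V_vertical B_sharp i j (O_ s Is).
  by under eq_bigr => k _ do rewrite cE.
have dmixed : is_derive (t : R^o) 1 (fun s : R^o => mixed_bracket g0 pi g W ch V i j s u)
    ((dS : 'rV[R]_(n + p))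
     - 2 *: bracket (fun v => Vl i (t, v)) (fun v => Vl j (t, v)) u).
  have B1 : bracket (fun v => 'D_dt (Vl i) (t, v)) (fun v => F j (t, v)) u
      = bracket (local_field ch (dV i)) (fun v => F j (t, v)) u.
    exact: (bracket_eq_on oU Uu (dVlocal i) (fun v _ => erefl (F j (t, v)))).
  have B2 : bracket (fun v => F i (t, v)) (fun v => 'D_dt (Vl j) (t, v)) u
      = bracket (fun v => F i (t, v)) (local_field ch (dV j)) u.
    exact: (bracket_eq_on oU Uu (fun v _ => erefl (F i (t, v))) (dVlocal j)).
  have dM := is_derive_mixed_bracket g0_metric pi_g0 g_variation pi_g W_smooth
    W_orthonormal ac ad V_smooth V_vertical B_sharp i j (O_ t It).
  exact (is_derive_eq dM (f_equal2 (fun a b : 'rV[R]_(n + p) => a - b)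
    (etrans (f_equal2 (fun a b : 'rV[R]_(n + p) => a + b) B1 B2) (esym dSE)) erefl)).
have gT : (g t x)^T = g t x by exact: (family_sym g_variation x It).
have [D1 D2] := squared_norm_variation gT oI It secE dA dVu dmixed.
split.
  apply: is_derive_eq D1 _; rewrite -/S -AE.
  by under eq_bigr => k _ do rewrite VuE.
apply: is_derive_eq D2 _; rewrite -SE -AE.
under eq_bigr => k _ do rewrite dVx.
under [X in _ - 3 / 2 * X + _]eq_bigr => k _ do under eq_bigr => l _ do rewrite !VuE.
under [X in _ + 3 * X + _]eq_bigr => k _ do rewrite VuE.
by [].
Qed.
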